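(* Let $n\in\mathbb{N}=\{1,2,\dots\}$. The complex partial Brauer algebra $\mathfrak{R}_n(\delta,\delta')$ is generically semisimple; that is, there is a nonempty Zariski open subset $U\subset\mathbb{C}^2$ such that the $\mathbb{C}$-algebra $\mathfrak{R}_n(\delta,\delta')$ is semisimple for all $(\delta,\delta')\in U$.
   Context: Let $\underline{n}=\{1,\dots,n\}$, $\underline{n}'=\{1',\dots,n'\}$ and $\mathbf{n}=\underline{n}\sqcup\underline{n}'$. Let $\mathtt{R}_n$ be the set of all set partitions of $\mathbf{n}$ into parts of size $1$ (singletons) or $2$ (pair parts). For $d,d'\in\mathtt{R}_n$, let $d|d'$ be the graph obtained by identifying the vertex $i'$ of $d$ with the vertex $i$ of $d'$ for each $i=1,\dots,n$ (these $n$ identified vertices form the equator), with edges the pair parts of $d$ and of $d'$. Every connected component is a path (possibly a single vertex) or a closed loop. Let $d\circ d'\in\mathtt{R}_n$ be the partition of (the vertices $\underline{n}$ of $d$) $\sqcup$ (the vertices $\underline{n}'$ of $d'$) whose parts are the nonempty intersections of connected components of $d|d'$ with this set. For $\delta,\delta'\in\mathbb{C}$, the partial Brauer algebra $\mathfrak{R}_n(\delta,\delta')$ is the $\mathbb{C}$-vector space with basis $\mathtt{R}_n$ and multiplication $dd'=\delta^{a}{\delta'}^{b}\,d\circ d'$, where $a$ is the number of closed loops contained in the equator and $b$ is the number of open strings (paths, including isolated single vertices) contained in the equator of $d|d'$. *)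

(* Defs.v *)
From HB Require Import structures.
From mathcomp Require Import mpoly.
From mathcomp Require Import all_boot all_order all_algebra all_field.

Set Implicit Arguments.
Unset Strict Implicit.
Unset Printing Implicit Defensive.

(* The vertices 1, ..., n and 1', ..., n' of a diagram are the elements       *)
(* [inl i] and [inr i] of ['I_n + 'I_n].                                      *)

Definition is_diagram n (P : {set {set 'I_n + 'I_n}}) :=
  partition P [set: 'I_n + 'I_n] && [forall B in P, #|B| <= 2].

Record diagram n := Diagram {
  parts :> {set {set 'I_n + 'I_n}};
  diagramP : is_diagram parts
}.

HB.instance Definition _ n := [isSub for @parts n].
HB.instance Definition _ n := [Finite of diagram n by <:].

(* Vertices of the graph d|d': [inl (inl i)] is the vertex i of d,            *)
(* [inl (inr i)] is the vertex i' of d', and [inr i] is the equator vertex    *)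
(* obtained by identifying i' in d with i in d'.                              *)
Definition stacked n := ('I_n + 'I_n + 'I_n)%type.

Definition upper n (v : 'I_n + 'I_n) : stacked n :=
  match v with inl i => inl (inl i) | inr i => inr i end.

Definition lower n (v : 'I_n + 'I_n) : stacked n :=
  match v with inl i => inr i | inr i => inl (inr i) end.

Definition same_part n (T : finType) (f : 'I_n + 'I_n -> T) (d : diagram n)
    : rel T :=
  fun x y => [exists B in parts d, (x \in f @: B) && (y \in f @: B)].

Definition stack_rel n (d d' : diagram n) : rel (stacked n) :=
  fun x y => same_part (@upper n) d x y || same_part (@lower n) d' x y.

Definition components n (d d' : diagram n) : {set {set stacked n}} :=
  equivalence_partition (connect (stack_rel d d')) [set: stacked n].

(* The vertices of d|d' off the equator form the copy [inl] of ['I_n + 'I_n]. *)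
Definition compose_parts n (d d' : diagram n) : {set {set 'I_n + 'I_n}} :=
  [set inl @^-1: C | C : {set stacked n} in components d d'] :\ set0.

Definition equator n : {set stacked n} := [set inr i | i : 'I_n].

(* Edges of d|d' are counted with multiplicity: if {i', j'} is a part of d    *)
(* and {i, j} a part of d', the two equator vertices are joined by two edges  *)
(* and form a closed loop.                                                    *)
Definition degree n (d d' : diagram n) (x : stacked n) :=
  #|[set B in parts d | (#|B| == 2) && (x \in @upper n @: B)]|
  + #|[set B in parts d' | (#|B| == 2) && (x \in @lower n @: B)]|.

(* A component is a path or a closed loop, and it is a closed loop exactly    *)
(* when the degree of each of its vertices is 2; an isolated vertex is a path.*)
Definition is_loop n (d d' : diagram n) (C : {set stacked n}) :=
  [forall x in C, degree d d' x == 2].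

Definition n_loops n (d d' : diagram n) :=
  #|[set C in components d d' | (C \subset equator n) && is_loop d d' C]|.

Definition n_strings n (d d' : diagram n) :=
  #|[set C in components d d' | (C \subset equator n) && ~~ is_loop d d' C]|.

(* Orbits of a pair of involutions: a component of d|d' is such an orbit for  *)
(* the partner maps of d and d', with two ends when it is a path, else none.  *)
Section TwoInvolutions.
Variables (T : finType) (s t : T -> T).
Hypotheses (sK : involutive s) (tK : involutive t).

Let step : rel T := fun x y => (y == s x) || (y == t x).
Let move (p : T * bool) := if p.2 then s p.1 else t p.1.
Let flags (S : {set T}) : {set T * bool} :=
  [set p | (p.1 \in S) && ((move p \notin S) || (move p == p.1))].

Let moveK p : move (move p, p.2) = p.1.
Proof. by case: p => x []; rewrite /move /= ?sK ?tK. Qed.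

Let flags_grow (S : {set T}) p : p.1 \in S -> move p \notin S ->
  #|flags (move p |: S)| <= #|flags S|.
Proof.
move=> pS mpS.
have sub : flags (move p |: S) \subset (move p, ~~ p.2) |: (flags S :\ p).
  apply/subsetP=> q; rewrite !inE => /andP[].
  case/orP=> [/eqP q1|q1].
    have [q2|q2] := boolP (q.2 == p.2).
      have -> : q = (move p, p.2) by rewrite (surjective_pairing q) q1 (eqP q2).
      rewrite moveK /= pS orbT /= => /eqP e.
      by move: mpS; rewrite -e pS.
    have -> : q = (move p, ~~ p.2) by rewrite (surjective_pairing q) q1; case: (q.2) (p.2) q2 => [] [].
    by rewrite eqxx.
  rewrite negb_or => H; rewrite q1 /=.
  have [e|_] := eqVneq q p.
    move: H; rewrite e eqxx /= => /eqP e'.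
    by move: mpS; rewrite e' pS.
  rewrite /=; apply/orP; right; apply/orP.
  by case/orP: H => [/andP[_ ?]|?]; [left|right].
have pF : p \in flags S by rewrite inE pS mpS.
apply: leq_trans (subset_leq_card sub) _.
rewrite cardsU1 [#|flags S|](cardsD1 p) pF.
by case: (_ \notin _).
Qed.

Let flags_le2 r : #|flags [set x | connect step r x]| <= 2.
Proof.
set C := [set x | _].
have grow k (S : {set T}) : #|C| - #|S| <= k -> r \in S -> S \subset C ->
    #|flags S| <= 2 -> #|flags C| <= 2.
  elim: k S => [|k IH] S; rewrite ?leqn0 => le_k rS sSC FS.
    suff <- : S = C by [].
    by apply/eqP; rewrite eqEcard sSC -subn_eq0.
  case: (pickP [pred p | (p.1 \in S) && (move p \notin S)]) => [p /andP[pS mpS]|nomove].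
    have mpC : move p \in C.
      have := subsetP sSC _ pS; rewrite !inE => /connect_trans; apply.
      by apply: connect1; rewrite /step /move; case: (p.2); rewrite eqxx ?orbT.
    have sub' : move p |: S \subset C by rewrite subUset sub1set mpC.
    apply: (IH (move p |: S)) => //; last 2 first.
    - by rewrite !inE rS orbT.
    - exact: leq_trans (flags_grow pS mpS) FS.
    rewrite cardsU1 mpS /= add1n subnS.
    by move: le_k; case: (_ - _).
  have cS x : x \in S -> (s x \in S) && (t x \in S).
    move=> xS; have := (nomove (x, true)); have := nomove (x, false).
    by rewrite /= xS /move /= => /negbFE -> /negbFE ->.
  have cp q z : z \in S -> path step z q -> last z q \in S.
    elim: q z => //= y q IHq z zS /andP[zy /IHq]; apply.
    by case/orP: zy => /eqP->; case/andP: (cS _ zS).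
  suff <- : S = C by [].
  apply/eqP; rewrite eqEsubset sSC; apply/subsetP => x; rewrite inE.
  by case/connectP=> q /(cp _ _ rS) ? ->.
have rC : [set r] \subset C by rewrite sub1set inE.
apply: (grow _ [set r] (leqnn _) (set11 r) rC).
have : flags [set r] \subset [set (r, true); (r, false)].
  by apply/subsetP=> -[x []]; rewrite !inE /= => /andP[/eqP-> _]; rewrite !eqxx ?orbT.
by move/subset_leq_card=> h; apply: leq_trans h _; rewrite cards2; case: (_ != _).
Qed.

Lemma odd_fixed (u : T -> T) (C : {set T}) : involutive u ->
  (forall x, x \in C -> u x \in C) -> odd #|[set x in C | u x == x]| = odd #|C|.
Proof.
move=> uK; have [k] := ubnP #|C|; elim: k C => // k IH C.
rewrite ltnS => le_k cC.
case: (pickP [pred x in C | u x != x]) => [x /andP[xC ux]|nof]; last first.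
  congr (odd #|pred_of_set _|); apply/setP=> x; rewrite inE.
  by case xC: (x \in C) => //=; have := nof x; rewrite /= xC /= => /negbFE.
have [uxC] := (cC _ xC).
have xyC : [set x; u x] \subset C by rewrite subUset !sub1set xC uxC.
have -> : [set y in C | u y == y] = [set y in C :\: [set x; u x] | u y == y].
  apply/setP=> y; rewrite !inE; have [->|_] /= := eqVneq y x.
    by rewrite (negbTE ux) andbF.
  by have [->|//] := eqVneq y (u x); rewrite uK eq_sym (negbTE ux) andbF.
have cc : #|C| = (#|C :\: [set x; u x]|).+2.
  by rewrite -(cardsID [set x; u x] C) (setIidPr xyC) cards2 eq_sym ux.
rewrite IH.
- by rewrite cc /= negbK.
- by rewrite cc in le_k; apply: leq_trans le_k.
move=> y; rewrite !inE => /andP[yn yC]; rewrite cC // andbT.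
rewrite (inv_eq uK) (inj_eq (inv_inj uK)).
by rewrite orbC.
Qed.

Lemma two_ends r : let C := [set x | connect step r x] in
  let m := #|[set x in C | s x == x]| + #|[set x in C | t x == x]| in
  0 < m -> m = 2.
Proof.
move=> C m m0.
have cC x u : (forall x, step x (u x)) -> x \in C -> u x \in C.
  by move=> Hu; rewrite !inE => /connect_trans; apply; apply: connect1.
have em : ~~ odd m.
  rewrite /m oddD !odd_fixed ?addbb //; move=> x; apply: cC => y; by rewrite /step eqxx ?orbT.
suff : m <= 2 by case: (m) m0 em => [|[|[|]]].
have := flags_le2 r; rewrite -/C; apply: leq_trans; rewrite /m.
rewrite -(card_imset _ (fun x y (e : (x, true) = (y, true)) => congr1 fst e)).
rewrite -[X in _ + X](card_imset _ (fun x y (e : (x, false) = (y, false)) => congr1 fst e)).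
set A := imset _ _; set B := imset _ _.
have dAB : A :&: B = set0.
  by apply/setP=> -[x b]; rewrite !inE; apply/negP=> /andP[/imsetP[? _ [_ ->]] /imsetP[]].
rewrite -cardsUI dAB cards0 addn0; apply: subset_leq_card.
apply/subsetP=> p; rewrite in_setU => /orP[] /imsetP[x].
  by rewrite inE => /andP[xC fx] ->; rewrite inE xC /move /= fx orbT.
by rewrite inE => /andP[xC fx] ->; rewrite inE xC /move /= fx orbT.
Qed.
End TwoInvolutions.

Section Partner.
Variables (n : nat) (d : diagram n).
Local Notation V := ('I_n + 'I_n)%type.

Let dpart : partition d [set: V]. Proof. by case/andP: (diagramP d). Qed.
Let dtriv : trivIset d. Proof. by case/and3P: dpart. Qed.
Let dcover x : x \in cover d.
Proof. by rewrite (cover_partition dpart) inE. Qed.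

Lemma card_part B : B \in parts d -> 0 < #|B| <= 2.
Proof.
case/andP: (diagramP d) => /and3P[_ _ d0] /forallP/(_ B) /implyP le2 Bd.
by rewrite le2 // andbT card_gt0; apply: contraNneq d0 => <-.
Qed.

Definition same x y := y \in pblock d x.

Lemma same_partE (T : finType) (f : V -> T) x y : injective f ->
  same_part f d (f x) (f y) = same x y.
Proof.
move=> f_inj; apply/exists_inP/idP => [[B Bd]|xy].
  rewrite !mem_imset // => /andP[xB yB].
  by rewrite /same (def_pblock dtriv Bd xB).
exists (pblock d x); first exact: pblock_mem.
by rewrite !mem_imset // mem_pblock dcover.
Qed.

Lemma same_partP (T : finType) (f : V -> T) x y : injective f ->
  reflect (exists a b, [/\ x = f a, y = f b & same a b]) (same_part f d x y).
Proof.
move=> f_inj; apply: (iffP idP) => [|[a [b [-> ->]]]]; last by rewrite same_partE.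
case/exists_inP=> B Bd /andP[/imsetP[a aB xa] /imsetP[b bB yb]].
by exists a, b; split; rewrite // /same (def_pblock dtriv Bd aB).
Qed.

Lemma same_refl x : same x x.
Proof. by rewrite /same mem_pblock. Qed.

Lemma same_pb x y : same x y -> pblock d x = pblock d y.
Proof. by move/(same_pblock dtriv). Qed.

Lemma same_sym x y : same x y = same y x.
Proof. by apply/idP/idP=> H; rewrite /same -(same_pb H) mem_pblock dcover. Qed.

Lemma same_trans : transitive same.
Proof. by move=> y x z xy; rewrite /same (same_pb xy). Qed.

Definition partner x := odflt x [pick y in pblock d x | y != x].

Lemma sameE x y : same x y = (y == x) || (y == partner x).
Proof.
rewrite /partner; case: pickP => [z /= /andP[xz zx]|no] /=; last first.
  rewrite orbb; apply/idP/eqP => [xy|->]; last exact: same_refl.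
  by apply/eqP; have := no y; rewrite [_ \in _]xy /= => /negbFE.
suff : pblock d x = [set x; z] by move=> e; rewrite /same e !inE.
apply/esym/eqP; rewrite eqEcard subUset !sub1set xz mem_pblock dcover /=.
rewrite cards2 eq_sym zx.
by case/andP: (card_part (pblock_mem (dcover x))).
Qed.

Lemma partnerK : involutive partner.
Proof.
move=> x; have := sameE x (partner x); rewrite eqxx orbT => xp.
have := sameE (partner x) x; rewrite same_sym xp => /esym/orP[/eqP e|/eqP//].
by rewrite -e -e.
Qed.

Lemma partner_fix x : (partner x == x) = ([set x] \in parts d).
Proof.
apply/eqP/idP => [e|xd].
  suff <- : pblock d x = [set x] by apply: pblock_mem.
  by apply/setP=> y; rewrite [LHS]sameE e orbb inE.
have := sameE x (partner x); rewrite eqxx orbT /same (def_pblock dtriv xd (set11 x)).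
by rewrite inE => /eqP.
Qed.

Lemma partsE : parts d = equivalence_partition same [set: V].
Proof. by rewrite -{1}(equivalence_partition_pblock dpart). Qed.

Section Lift.
Variables (T : finType) (f : V -> T).
Hypothesis f_inj : injective f.

Definition marked : {set T} := [set f a | a : V & [set a] \in parts d].

Definition partner_ext x := if [pick a | f a == x] is Some a then f (partner a) else x.

Lemma marked_in a : (f a \in marked) = ([set a] \in parts d).
Proof.
apply/imsetP/idP => [[b]|ad]; last by exists a; rewrite // inE.
by rewrite inE => bd /f_inj->.
Qed.

Lemma partner_extE a : partner_ext (f a) = f (partner a).
Proof.
rewrite /partner_ext; case: pickP => [b /eqP/f_inj -> //|/(_ a)].
by rewrite eqxx.
Qed.

Lemma partner_ext_out x : x \notin codom f -> partner_ext x = x.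
Proof.
by rewrite /partner_ext; case: pickP => // a /eqP <-; rewrite codom_f.
Qed.

Lemma partner_extK : involutive partner_ext.
Proof.
move=> x; have [/codomP[a ->]|xn] := boolP (x \in codom f).
  by rewrite !partner_extE partnerK.
by rewrite !partner_ext_out // partner_ext_out.
Qed.

Lemma partner_ext_fix x : (partner_ext x == x) = (x \in marked) || (x \notin codom f).
Proof.
have [/codomP[a ->]|xn] := boolP (x \in codom f); last first.
  by rewrite partner_ext_out // eqxx orbT.
by rewrite orbF partner_extE (inj_eq f_inj) partner_fix marked_in.
Qed.

Lemma same_part_ext x y :
  (y == x) || same_part f d x y = (y == x) || (y == partner_ext x).
Proof.
have [//|yx] := eqVneq y x; rewrite orFb.
have [/codomP[a xa]|xn] := boolP (x \in codom f); last first.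
  rewrite partner_ext_out // (negbTE yx); apply/(same_partP _ _ f_inj) => -[a [b [xa _ _]]].
  by rewrite xa codom_f in xn.
rewrite xa partner_extE in yx *; have [/codomP[b yb]|yn] := boolP (y \in codom f).
  move: yx; rewrite yb same_partE // sameE !(inj_eq f_inj).
  by move/negbTE->.
apply/idP/eqP => [/(same_partP _ _ f_inj)[? [b [_ yb _]]]|yb]; last first.
  by rewrite yb codom_f in yn.
by rewrite yb codom_f in yn.
Qed.

Lemma same_part_sym : symmetric (same_part f d).
Proof.
by move=> x y; apply: eq_existsb => B; rewrite [(x \in _) && _]andbC.
Qed.
End Lift.
End Partner.

Lemma diagram_eq n (d e : diagram n) : same d =2 same e -> d = e.
Proof.
move=> H; apply: val_inj; rewrite /= !partsE; apply: eq_imset => x /=.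
by apply/setP=> y; rewrite !inE H.
Qed.

Lemma upper_inj n : injective (@upper n).
Proof. by move=> [i|i] [j|j] // [->]. Qed.

Lemma lower_inj n : injective (@lower n).
Proof. by move=> [i|i] [j|j] // [->]. Qed.

Section Classes.
Variables (T : finType) (e : rel T).
Hypothesis e_sym : symmetric e.
Definition conn_classes := equivalence_partition (connect e) [set: T].

Lemma conn_classesP (C : {set T}) :
  reflect (exists x, C = [set y | connect e x y]) (C \in conn_classes).
Proof.
apply: (iffP imsetP) => [[x _ ->]|[x ->]]; exists x => //.
  by apply/setP=> y; rewrite !inE.
by apply/setP=> y; rewrite !inE.
Qed.

Lemma connect_equiv : {in [set: T] & &, equivalence_rel (connect e)}.
Proof.
move=> x y z _ _ _; split=> // xy.
exact: (same_connect (sym_connect_sym e_sym) xy).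
Qed.

Lemma class_conn C x y : C \in conn_classes -> x \in C -> (y \in C) = connect e x y.
Proof.
case/conn_classesP=> z ->; rewrite !inE => zx.
by rewrite (same_connect (sym_connect_sym e_sym) zx).
Qed.
End Classes.

Lemma connect_inv (T : finType) (e : rel T) (P : T -> Prop) x :
  P x -> (forall y z, connect e x y -> P y -> e y z -> P z) ->
  forall y, connect e x y -> P y.
Proof.
move=> Px H y /connectP[p]; elim/last_ind: p y => [|p z IH] y; first by move=> _ ->.
rewrite rcons_path last_rcons => /andP[pp pz] ->.
apply: H pz; first by apply/connectP; exists p.
exact: IH.
Qed.

Section Compose.
Variables (n : nat) (d d' : diagram n).
Local Notation V := ('I_n + 'I_n)%type.
Local Notation r := (stack_rel d d').
Local Notation s := (partner_ext d (@upper n)).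
Local Notation t := (partner_ext d' (@lower n)).

Lemma stack_rel_sym : symmetric r.
Proof. by move=> x y; rewrite /stack_rel !(same_part_sym _ _ x y). Qed.

Let stack_connect : connect r =2 connect (fun x y => (y == s x) || (y == t x)).
Proof.
have su x y := same_part_ext d (@upper_inj n) x y.
have sl x y := same_part_ext d' (@lower_inj n) x y.
move=> x y; apply/idP/idP; apply: connect_sub => {}x {}y.
  rewrite /stack_rel => xy.
  have [->|yx] := eqVneq y x; first exact: connect0.
  apply: connect1; have := su x y; have := sl x y; rewrite (negbTE yx) /=.
  by move=> <- <-.
move=> xy; have [->|yx] := eqVneq y x; first exact: connect0.
apply: connect1; have := su x y; have := sl x y; rewrite (negbTE yx) /stack_rel /=.
by move=> -> ->.
Qed.

Let codom_upper x : (x \notin codom (@upper n)) = (if x is inl (inr i) then true else false).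
Proof.
case: x => [[i|i]|i].
- by apply/negbTE; rewrite negbK; apply/codomP; exists (inl i).
- by apply/codomP => -[[j|j]].
- by apply/negbTE; rewrite negbK; apply/codomP; exists (inr i).
Qed.

Let codom_lower x : (x \notin codom (@lower n)) = (if x is inl (inl i) then true else false).
Proof.
case: x => [[i|i]|i].
- by apply/codomP => -[[j|j]].
- by apply/negbTE; rewrite negbK; apply/codomP; exists (inr i).
- by apply/negbTE; rewrite negbK; apply/codomP; exists (inl i).
Qed.

Let marks (C : {set stacked n}) :=
  #|C :&: marked d (@upper n)| + #|C :&: marked d' (@lower n)|.

Let marked_upper_out i : inl (inr i) \notin marked d (@upper n).
Proof. by apply/imsetP => -[[]]. Qed.

Let marked_lower_out i : inl (inl i) \notin marked d' (@lower n).
Proof. by apply/imsetP => -[[]]. Qed.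

Let ends v : let C := [set y | connect r (inl v) y] in
  #|inl @^-1: C| + marks C = 2.
Proof.
move=> C.
have := @two_ends _ s t (partner_extK d (@upper_inj n)) (partner_extK d' (@lower_inj n)) (inl v); cbv zeta.
have -> : [set x | connect (fun x y => (y == s x) || (y == t x)) (inl v) x] = C.
  by apply/setP=> y; rewrite !inE stack_connect.
set m := (X in 0 < X -> _) => Hm.
suff e : #|inl @^-1: C| + marks C = m.
  rewrite e; apply: Hm; rewrite -e addn_gt0 card_gt0; apply/orP; left.
  by apply/set0Pn; exists v; rewrite !inE.
have cV : #|inl @^-1: C| = #|[set i : 'I_n | inl (inl i) \in C]|
                         + #|[set i : 'I_n | inl (inr i) \in C]|.
  rewrite -!sum1_card big_sumType /=; congr (_ + _);
    by apply: eq_bigl => i; rewrite !inE.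
have cS : #|[set x in C | s x == x]|
        = #|C :&: marked d (@upper n)| + #|[set i : 'I_n | inl (inr i) \in C]|.
  rewrite -(card_imset [set i | inl (inr i) \in C] (f := fun i => inl (inr i) : stacked n)); last by move=> ? ? [].
  rewrite -cardsUI [X in _ = _ + X](_ : _ = 0); last first.
    apply/eqP; rewrite cards_eq0; apply/eqP/setP => x; rewrite in_setI in_set0.
    apply/negP=> /andP[xm /imsetP[i _ xi]]; move: xm; rewrite xi in_setI.
    by rewrite (negbTE (marked_upper_out i)) andbF.
  rewrite addn0; congr #|pred_of_set _|; apply/setP=> x; rewrite in_setU in_setI in_set.
  rewrite (partner_ext_fix d (@upper_inj n)) andb_orr codom_upper; congr (_ || _).
  case: x => [[i|i]|i]; rewrite ?andbF ?andbT; apply/idP/imsetP => //.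
  - by case.
  - by move=> iC; exists i => //; rewrite in_set.
  - by case=> j; rewrite in_set => jC [->].
  - by case.
have cT : #|[set x in C | t x == x]|
        = #|C :&: marked d' (@lower n)| + #|[set i : 'I_n | inl (inl i) \in C]|.
  rewrite -(card_imset [set i | inl (inl i) \in C] (f := fun i => inl (inl i) : stacked n)); last by move=> ? ? [].
  rewrite -cardsUI [X in _ = _ + X](_ : _ = 0); last first.
    apply/eqP; rewrite cards_eq0; apply/eqP/setP => x; rewrite in_setI in_set0.
    apply/negP=> /andP[xm /imsetP[i _ xi]]; move: xm; rewrite xi in_setI.
    by rewrite (negbTE (marked_lower_out i)) andbF.
  rewrite addn0; congr #|pred_of_set _|; apply/setP=> x; rewrite in_setU in_setI in_set.
  rewrite (partner_ext_fix d' (@lower_inj n)) andb_orr codom_lower; congr (_ || _).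
  case: x => [[i|i]|i]; rewrite ?andbF ?andbT; apply/idP/imsetP => //.
  - by move=> iC; exists i => //; rewrite in_set.
  - by case=> j; rewrite in_set => jC [->].
  - by case.
  - by case.
rewrite /m cS cT cV /marks.
by rewrite addnC [X in _ + X = _]addnC addnACA.
Qed.

Let conn_equiv : {in [set: V] & &,
  equivalence_rel (fun v w : V => connect r (inl v) (inl w))}.
Proof.
move=> x y z _ _ _; split=> // xy.
exact: (same_connect (sym_connect_sym stack_rel_sym) xy).
Qed.

Let compose_partsE : compose_parts d d' =
  equivalence_partition (fun v w : V => connect r (inl v) (inl w)) [set: V].
Proof.
apply/setP=> B; rewrite in_setD1; apply/andP/imsetP => [[B0 /imsetP[C]]|[v _ ->]].
  case/conn_classesP=> x -> eB; move: B0; rewrite eB => /set0Pn[v]; rewrite !inE => xv.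
  exists v => //; apply/setP=> w; rewrite !inE /=.
  by rewrite (same_connect (sym_connect_sym stack_rel_sym) xv).
split; first by apply/set0Pn; exists v; rewrite !inE connect0.
apply/imsetP; exists [set y | connect r (inl v) y]; first by apply/conn_classesP; exists (inl v).
by apply/setP=> w; rewrite !inE.
Qed.

Lemma compose_subproof : is_diagram (compose_parts d d').
Proof.
apply/andP; split.
  by rewrite compose_partsE; apply: equivalence_partitionP; exact: conn_equiv.
rewrite compose_partsE; apply/forallP=> B; apply/implyP=> /imsetP[v _ ->].
have <- := ends v; apply: leq_trans (leq_addr _ _).
by apply: subset_leq_card; apply/subsetP=> w; rewrite !inE.
Qed.

Definition compose := Diagram compose_subproof.

Lemma same_compose v w : same compose v w = connect r (inl v) (inl w).
Proof.
rewrite /same /= compose_partsE; apply: pblock_equivalence_partition.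
- exact: conn_equiv.
- by rewrite inE.
- by rewrite inE.
Qed.

Lemma compose_single v : ([set v] \in parts compose) =
  [exists z in marked d (@upper n) :|: marked d' (@lower n), connect r (inl v) z].
Proof.
have := ends v; set C := [set y | _]; move=> /= e.
have -> : ([set v] \in parts compose) = (#|inl @^-1: C| == 1).
  rewrite -partner_fix; apply/eqP/cards1P => [pv|[w wC]].
    exists v; apply/setP=> w; rewrite !inE -same_compose sameE pv orbb.
    by [].
  have : partner compose v \in inl @^-1: C.
    by rewrite !inE -same_compose sameE eqxx orbT.
  have : v \in inl @^-1: C by rewrite !inE.
  by rewrite wC !inE => /eqP -> /eqP.
have -> : (#|inl @^-1: C| == 1) = (0 < marks C).
  have v0 : 0 < #|inl @^-1: C| by rewrite card_gt0; apply/set0Pn; exists v; rewrite !inE.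
  by case: (#|_ @^-1: C|) v0 e => [|[|[|k]]] // _; case: (marks C) => [|[|[|m]]].
rewrite /marks addn_gt0 !card_gt0; apply/orP/exists_inP.
  by case=> /set0Pn[z /setIP[zC zm]]; exists z; rewrite ?inE ?zm ?orbT //; move: zC; rewrite inE.
case=> z /setUP[] zm zC; [left|right]; apply/set0Pn; exists z; by rewrite in_setI zm inE zC.
Qed.

Let degree_part (f : V -> stacked n) (e : diagram n) a : injective f ->
  #|[set B in parts e | (#|B| == 2) && (f a \in f @: B)]| = ([set a] \notin parts e).
Proof.
move=> f_inj.
have ed : partition e [set: V] by case/andP: (diagramP e).
have et : trivIset e by case/and3P: ed.
have ec : a \in cover e by rewrite (cover_partition ed) inE.
have pe := pblock_mem ec.
have -> : ([set a] \in parts e) = (#|pblock e a| == 1).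
  apply/idP/cards1P => [ae|[b eb]].
    by exists a; rewrite (def_pblock et ae) ?inE.
  have : a \in pblock e a by rewrite mem_pblock.
  by rewrite eb inE => /eqP ->; rewrite -eb.
have -> : [set B in parts e | (#|B| == 2) && (f a \in f @: B)] =
          if #|pblock e a| == 2 then [set pblock e a] else set0.
  apply/setP=> B; rewrite !inE mem_imset //.
  apply/and3P/idP => [[Be B2 aB]|].
    by rewrite (def_pblock et Be aB) B2 inE.
  by case: ifP => [e2|]; rewrite !inE // => /eqP ->; rewrite mem_pblock.
have := card_part pe.
by case: (#|pblock e a|) => [|[|[|k]]] //= _; rewrite ?cards0 ?cards1.
Qed.

Lemma is_loopE (C : {set stacked n}) : C \subset equator n ->
  is_loop d d' C = [disjoint C & marked d (@upper n)] && [disjoint C & marked d' (@lower n)].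
Proof.
move=> Ceq.
have deg i : (degree d d' (inr i) == 2) =
    (inr i \notin marked d (@upper n)) && (inr i \notin marked d' (@lower n)).
  have -> : degree d d' (inr i) = ([set inr i] \notin parts d) + ([set inl i] \notin parts d').
    by congr (_ + _); [apply: (degree_part d (inr i) (@upper_inj n))|apply: (degree_part d' (inl i) (@lower_inj n))].
  have -> : (inr i \in marked d (@upper n)) = ([set inr i] \in parts d).
    exact: (marked_in d (@upper_inj n) (inr i)).
  have -> : (inr i \in marked d' (@lower n)) = ([set inl i] \in parts d').
    exact: (marked_in d' (@lower_inj n) (inl i)).
  by case: (_ \in _); case: (_ \in _).
apply/forall_inP/andP => [H|[/disjoint_setI0 H1 /disjoint_setI0 H2] x xC].
  split; apply/pred0P => x; apply/negbTE/negP => /andP[/= xC xm];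
    have /imsetP[i _ xi] := subsetP Ceq _ xC; move: (H _ xC) xm; rewrite xi deg;
    by case/andP=> /negP m1 /negP m2; first [exact: m1 | exact: m2].
have /imsetP[i _ xi] := subsetP Ceq _ xC; rewrite xi deg -xi; apply/andP; split.
  by apply/negP=> xm; have : x \in set0 by [rewrite -H1 in_setI xC]; rewrite in_set0.
by apply/negP=> xm; have : x \in set0 by [rewrite -H2 in_setI xC]; rewrite in_set0.
Qed.
End Compose.

(* W is the vertex set of the graph d1|d2|d3, with its two equators. The      *)
(* embeddings i and j present it as the graph of two adjacent factors da, db  *)
(* and as the graph of their composite with the remaining factor dc.          *)
Section Glue.
Variables (n : nat) (W : finType) (da db dc : diagram n).
Variables (i j : stacked n -> W) (eps eps' : 'I_n + 'I_n -> stacked n).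
Hypotheses (i_inj : injective i) (j_inj : injective j).
Hypotheses (eps_inj : injective eps) (eps'_inj : injective eps').
Hypothesis j_eps : forall v, j (eps v) = i (inl v).
Hypothesis ij_meet : forall z y, i z = j y -> exists2 v, z = inl v & y = eps v.
Hypothesis ij_cover : forall w, (w \in codom i) || (w \in codom j).
Variable inner : {set W}.
Hypothesis i_inner : forall k, i (inr k) \in inner.
Hypothesis j_inner : forall y, (j y \in inner) = (y \in equator n).
Variables (fa fb fc : 'I_n + 'I_n -> W).
Hypotheses (Efa : forall v, fa v = i (upper v)) (Efb : forall v, fb v = i (lower v)).
Hypothesis (Efc : forall v, fc v = j (eps' v)).
Variables (r : rel (stacked n)) (q : rel W).
Hypothesis rE : forall x y,
  r x y = same_part eps (compose da db) x y || same_part eps' dc x y.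
Hypothesis qE : forall x y,
  q x y = [|| same_part fa da x y, same_part fb db x y | same_part fc dc x y].

Let fa_inj : injective fa.
Proof. by move=> v w; rewrite !Efa => /i_inj/upper_inj. Qed.
Let fb_inj : injective fb.
Proof. by move=> v w; rewrite !Efb => /i_inj/lower_inj. Qed.
Let fc_inj : injective fc.
Proof. by move=> v w; rewrite !Efc => /j_inj/eps'_inj. Qed.

Let r_sym : symmetric r.
Proof. by move=> x y; rewrite !rE !(same_part_sym _ _ x y). Qed.
Let q_sym : symmetric q.
Proof. by move=> x y; rewrite !qE !(same_part_sym _ _ x y). Qed.

Let q_i z z' : stack_rel da db z z' -> q (i z) (i z').
Proof.
rewrite qE; case/orP.
  case/(same_partP _ _ _ (@upper_inj n))=> a [b [-> -> ab]].
  by rewrite -!Efa same_partE // ab.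
case/(same_partP _ _ _ (@lower_inj n))=> a [b [-> -> ab]].
by rewrite -!Efb same_partE // ab orbT.
Qed.

Let q_iP w w' : q w w' ->
  (exists z z', [/\ w = i z, w' = i z' & stack_rel da db z z']) \/
  (exists y y', [/\ w = j y, w' = j y' & r y y']).
Proof.
rewrite qE; case/or3P.
- case/(same_partP _ _ _ fa_inj)=> a [b [-> -> ab]]; left.
  exists (upper a), (upper b); rewrite -!Efa; split=> //.
  by apply/orP; left; rewrite same_partE //; apply: upper_inj.
- case/(same_partP _ _ _ fb_inj)=> a [b [-> -> ab]]; left.
  exists (lower a), (lower b); rewrite -!Efb; split=> //.
  by apply/orP; right; rewrite same_partE //; apply: lower_inj.
case/(same_partP _ _ _ fc_inj)=> a [b [-> -> ab]]; right.
exists (eps' a), (eps' b); rewrite -!Efc; split=> //.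
by rewrite rE same_partE // ab orbT.
Qed.

Let conn_i z z' : connect (stack_rel da db) z z' -> connect q (i z) (i z').
Proof.
move: z'; apply: connect_inv => [|x y _ zx xy]; first exact: connect0.
exact: connect_trans zx (connect1 (q_i xy)).
Qed.

Let r_eps v w : r (eps v) (eps w) = 
  connect (stack_rel da db) (inl v) (inl w) || same_part eps' dc (eps v) (eps w).
Proof. by rewrite rE same_partE // same_compose. Qed.

Let conn_j x y : connect q (j x) (j y) = connect r x y.
Proof.
apply/idP/idP; last first.
  move: y; apply: connect_inv => [|y z _ xy]; first exact: connect0.
  rewrite rE => yz; apply: connect_trans xy _; case/orP: yz.
    case/(same_partP _ _ _ eps_inj)=> a [b [-> ->]]; rewrite same_compose !j_eps.
    exact: conn_i.
  case/(same_partP _ _ _ eps'_inj)=> a [b [-> -> ab]]; apply: connect1.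
  by rewrite qE -!Efc same_partE // ab !orbT.
move=> H.
pose P w := exists2 y, connect r x y &
  w = j y \/ (exists v z, [/\ y = eps v, w = i z & connect (stack_rel da db) (inl v) z]).
suff [y' xy' [/j_inj -> //|[v [z [yv jz vz]]]]] : P (j y).
  have [w zw yw] := ij_meet (esym jz); apply: connect_trans xy' _; apply: connect1.
  by rewrite yv yw r_eps -zw vz.
move: (j y) H; apply: connect_inv; first by exists x; [exact: connect0|left].
move=> w w' _ [y' xy' Hw] /q_iP[[z [z' [wz wz' zz']]]|[y1 [y2 [wy1 wy2 y12]]]].
  exists y' => //; right; case: Hw => [wy'|[v [z0 [yv wz0 vz0]]]].
    have [v zv yv] := ij_meet (etrans (esym wz) wy').
    by exists v, z'; split=> //; rewrite -zv; apply: connect1.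
  exists v, z'; split=> //; apply: connect_trans vz0 (connect1 _).
  by have -> : z0 = z by apply: i_inj; rewrite -wz0.
exists y2; last by left.
apply: connect_trans (connect1 y12); apply: connect_trans xy' _.
case: Hw => [wy'|[v [z0 [yv wz0 vz0]]]].
  by have -> : y' = y1 by [apply: j_inj; rewrite -wy'].
have [u zu yu] := ij_meet (etrans (esym wz0) wy1).
by apply: connect1; rewrite yv yu r_eps -zu vz0.
Qed.

Lemma glue_compose v w :
  connect r (inl v) (inl w) = connect q (j (inl v)) (j (inl w)).
Proof. by rewrite conn_j. Qed.

Definition free2 (C : {set stacked n}) (m m' : {set stacked n}) :=
  [disjoint C & m] && [disjoint C & m'].

Definition free3 (K : {set W}) :=
  [&& [disjoint K & marked da fa], [disjoint K & marked db fb] &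
      [disjoint K & marked dc fc]].

Let hidden (K : {set W}) := j @^-1: K == set0.

Let hiddenP (K : {set W}) : reflect (forall y, j y \notin K) (hidden K).
Proof.
apply: (iffP eqP) => [K0 y|H]; last by apply/setP=> y; rewrite !inE (negbTE (H y)).
by have : y \notin set0 by [rewrite inE]; rewrite -K0 inE.
Qed.

Let hidden_sub (K : {set W}) w : hidden K -> w \in K -> exists k, w = i (inr k).
Proof.
move/hiddenP=> hK wK; case/orP: (ij_cover w) => /codomP[z wz]; last first.
  by have := hK z; rewrite -wz wK.
case: z wz => [v|k] wz; last by exists k.
by have := hK (eps v); rewrite j_eps -wz wK.
Qed.

Let hidden_class z : 
  let C := [set z' | connect (stack_rel da db) z z'] in
  let K := [set w | connect q (i z) w] in
  (C \subset equator n) || hidden K -> K = i @: C /\ (C \subset equator n) && hidden K.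
Proof.
move=> C K H.
have iC z' : z' \in C -> i z' \in K by rewrite !inE; apply: conn_i.
have KC : K \subset i @: C.
  apply/subsetP=> w; rewrite inE.
  move: w; apply: connect_inv; first by apply: imset_f; rewrite inE.
  move=> w w' zw /imsetP[z1 z1C wz1] ww'.
  case/q_iP: (ww') => [[z2 [z3 [wz2 wz3 z23]]]|[y [y' [wy wy' yy']]]].
    rewrite wz3; apply: imset_f; move: z1C; rewrite !inE => /connect_trans; apply.
    by apply: connect1; have -> : z1 = z2 by [apply: i_inj; rewrite -wz1].
  case/orP: H => [/subsetP sC|/hiddenP hK]; last first.
    by have := hK y; rewrite inE -wy zw.
  have [v zv _] := ij_meet (etrans (esym wz1) wy).
  by have /imsetP[] := sC _ z1C; rewrite zv.
have eK : K = i @: C.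
  apply/eqP; rewrite eqEsubset KC; apply/subsetP=> _ /imsetP[z' zC ->].
  exact: iC.
split=> //; case/orP: H => [sC|hK].
  rewrite sC; apply/hiddenP=> y; rewrite eK; apply/imsetP=> -[z1 z1C /esym yz].
  have [v zv _] := ij_meet yz.
  by have /imsetP[] := subsetP sC _ z1C; rewrite zv.
rewrite hK andbT; apply/subsetP=> z' z'C.
have [k /i_inj ->] := hidden_sub hK (iC _ z'C).
exact: imset_f.
Qed.

Let disjoint_imset (T T' : finType) (f : T -> T') (C M : {set T}) :
  injective f -> [disjoint f @: C & f @: M] = [disjoint C & M].
Proof.
move=> f_inj; apply/idP/idP => /pred0P H; apply/pred0P => x /=.
  by have := H (f x); rewrite /= !mem_imset.
apply/negP=> /andP[/imsetP[y yC ->]]; rewrite mem_imset // => yM.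
by have := H y; rewrite /= yC yM.
Qed.

Let marked_comp (T T' : finType) (g : T -> T') (f : 'I_n + 'I_n -> T)
  (h : 'I_n + 'I_n -> T') d : (forall v, h v = g (f v)) -> marked d h = g @: marked d f.
Proof.
move=> E; rewrite /marked -imset_comp; apply: eq_imset => v; exact: E.
Qed.

Let count_hidden b :
  #|[set C in components da db | (C \subset equator n) && (is_loop da db C == b)]|
  = #|[set K in conn_classes q | (K \subset inner) && (free3 K == b)] :&: [set K | hidden K]|.
Proof.
set A := [set C in _ | _]; set B := _ :&: _.
have i_fr (C : {set stacked n}) : C \subset equator n -> hidden (i @: C) ->
    free3 (i @: C) = is_loop da db C.
  move=> Ceq /hiddenP hC; rewrite is_loopE // /free3 (marked_comp da Efa) (marked_comp db Efb).
  rewrite !disjoint_imset //; congr (_ && _); rewrite -[RHS]andbT; congr (_ && _).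
  apply/pred0P=> w /=; apply/negP=> /andP[wC /imsetP[a _ wa]].
  by have := hC (eps' a); rewrite -Efc -wa wC.
suff -> : B = [set i @: (C : {set _}) | C in A] by rewrite card_imset //; apply: imset_inj.
apply/setP=> K; rewrite /B inE [K \in [set _ | hidden _]]inE inE; apply/andP/imsetP.
  case=> /and3P[/conn_classesP[w Kw] KI Kb] hK.
  have wK : w \in K by rewrite Kw inE.
  have [k wk] := hidden_sub hK wK.
  have := @hidden_class (inr k); rewrite /= -wk -Kw hK orbT => /(_ isT)[eK].
  rewrite andbT => Ceq; exists [set z' | connect (stack_rel da db) (inr k) z'] => //.
  rewrite inE Ceq -(i_fr _ Ceq) -?eK // Kb !andbT.
  by apply/conn_classesP; exists (inr k).
case=> C; rewrite inE => /and3P[/conn_classesP[z Cz] Ceq Cb] eK.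
have := @hidden_class z; rewrite /= -Cz Ceq => /(_ isT)[eK' /= hK].
rewrite eK -eK' hK; split=> //; rewrite eK' i_fr // -?eK' // Cb andbT.
apply/andP; split; first by apply/conn_classesP; exists (i z).
apply/subsetP=> w; rewrite eK' => /imsetP[x xC ->].
by have /imsetP[k _ ->] := subsetP Ceq _ xC.
Qed.

Let count_visible b :
  #|[set C in conn_classes r | (C \subset equator n) &&
      (free2 C (marked (compose da db) eps) (marked dc eps') == b)]|
  = #|[set K in conn_classes q | (K \subset inner) && (free3 K == b)] :\: [set K | hidden K]|.
Proof.
set A := [set C in _ | _]; set B := _ :\: _.
have free (K : {set W}) : K \in conn_classes q -> ~~ hidden K ->
    free2 (j @^-1: K) (marked (compose da db) eps) (marked dc eps') = free3 K.
  move=> Kq hK; rewrite /free2 /free3 andbA; congr (_ && _); last first.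
    apply/idP/idP => /pred0P H; apply/pred0P => x /=; apply/negP=> /andP[].
      move=> xK; rewrite (marked_comp dc Efc) => /imsetP[y ym xy].
      by have := H y; rewrite /= ym inE -xy xK.
    rewrite inE => xK xm; have := H (j x); rewrite /= xK.
    by rewrite (marked_comp dc Efc) imset_f.
  rewrite (marked_comp da Efa) (marked_comp db Efb).
  have -> : [disjoint K & i @: marked da (@upper n)] && [disjoint K & i @: marked db (@lower n)]
     = [disjoint K & i @: (marked da (@upper n) :|: marked db (@lower n))].
    rewrite imsetU -!setI_eq0 setIUr setU_eq0.
    by [].
  apply/idP/idP => /pred0P H; apply/pred0P => x /=; apply/negP=> /andP[].
    move=> xK /imsetP[z zm xz].
    set C := [set z' | connect (stack_rel da db) z z'].
    have eK : K = [set w | connect q (i z) w].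
      by apply/setP=> w; rewrite inE -xz; apply: class_conn.
    have [Ceq|] := boolP (C \subset equator n).
      by have := @hidden_class z; rewrite /= -/C -eK Ceq (negbTE hK) => /(_ isT)[].
    case/subsetPn=> -[v|k]; last by rewrite imset_f.
    rewrite inE => zv _; have := H (eps v); rewrite /= inE j_eps eK inE conn_i //=.
    rewrite marked_in // compose_single => /negbT/negP; apply; apply/exists_inP; exists z => //.
    by rewrite (sym_connect_sym (@stack_rel_sym _ _ _)).
  rewrite inE => xK /imsetP[v]; rewrite inE compose_single => /exists_inP[z zm vz] xv.
  have := H (i z); rewrite /= (imset_f _ zm) andbT.
  by rewrite (class_conn q_sym _ Kq xK) xv j_eps conn_i.
have sub (K : {set W}) : (K \subset inner) = (j @^-1: K \subset equator n).
  apply/subsetP/subsetP => H x; first by rewrite inE => /H; rewrite j_inner.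
  move=> xK; case/orP: (ij_cover x) => /codomP[z xz].
    case: z xz => [v|k] xz; last by rewrite xz.
    by move: xK; rewrite xz -j_eps j_inner => vK; apply: H; rewrite inE.
  by rewrite xz j_inner; apply: H; rewrite inE -xz.
suff -> : A = [set j @^-1: (K : {set _}) | K in B].
  apply: card_in_imset => K K'; rewrite !inE.
  case/andP=> hK /and3P[Kq _ _] /andP[hK' /and3P[Kq' _ _]] e.
  case/set0Pn: (hK) => y; rewrite inE => yK.
  have yK' : j y \in K' by have : y \in j @^-1: K by [rewrite inE]; rewrite e inE.
  by apply/setP=> w; rewrite (class_conn q_sym _ Kq yK) (class_conn q_sym _ Kq' yK').
apply/setP=> C; rewrite inE; apply/and3P/imsetP => [[/conn_classesP[x Cx] Ceq Cb]|[K]].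
  exists [set w | connect q (j x) w]; last first.
    by rewrite Cx; apply/setP=> y; rewrite !inE conn_j.
  set K := [set w | _].
  have CK : C = j @^-1: K by rewrite Cx; apply/setP=> y; rewrite !inE conn_j.
  have hK : ~~ hidden K by apply/set0Pn; exists x; rewrite !inE.
  have Kq : K \in conn_classes q by apply/conn_classesP; exists (j x).
  by rewrite !inE hK Kq sub -CK Ceq -free // -CK Cb.
rewrite !inE => /andP[hK /and3P[Kq KI Kb]] ->; rewrite -sub free //; split=> //.
case/set0Pn: (hK) => y; rewrite inE => yK.
apply/conn_classesP; exists y; apply/setP=> x; rewrite !inE -conn_j.
exact: class_conn.
Qed.

Lemma glue_count b :
  #|[set C in components da db | (C \subset equator n) && (is_loop da db C == b)]|
  + #|[set C in conn_classes r | (C \subset equator n) &&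
      (free2 C (marked (compose da db) eps) (marked dc eps') == b)]|
  = #|[set K in conn_classes q | (K \subset inner) && (free3 K == b)]|.
Proof. by rewrite count_hidden count_visible cardsID. Qed.
End Glue.

Section Assoc.
Variables (n : nat) (d1 d2 d3 : diagram n).
Local Notation V := ('I_n + 'I_n)%type.
Local Notation W := (V + V)%type.

Let a1 (v : V) : W := match v with inl i => inl (inl i) | inr i => inr (inl i) end.
Let a2 (v : V) : W := inr v.
Let a3 (v : V) : W := match v with inl i => inr (inr i) | inr i => inl (inr i) end.

Let q : rel W := fun x y =>
  [|| same_part a1 d1 x y, same_part a2 d2 x y | same_part a3 d3 x y].
Let inner : {set W} := [set inr v | v : V].

Let i12 (z : stacked n) : W := match z with
  | inl (inl i) => inl (inl i) | inr i => inr (inl i) | inl (inr i) => inr (inr i) end.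
Let j12 (z : stacked n) : W := match z with inl v => inl v | inr i => inr (inr i) end.
Let i23 (z : stacked n) : W := match z with
  | inl (inl i) => inr (inl i) | inr i => inr (inr i) | inl (inr i) => inl (inr i) end.
Let j23 (z : stacked n) : W := match z with inl v => inl v | inr i => inr (inl i) end.

Let inj4 : [/\ injective i12, injective j12, injective i23 & injective j23].
Proof. by split=> -[[x|x]|x] [[y|y]|y] // [->]. Qed.

Let cnt b (d d' : diagram n) :=
  #|[set C in components d d' | (C \subset equator n) && (is_loop d d' C == b)]|.

Let free3 (K : {set W}) := 
  [&& [disjoint K & marked d1 a1], [disjoint K & marked d2 a2] & [disjoint K & marked d3 a3]].

Let total b := #|[set K in conn_classes q | (K \subset inner) && (free3 K == b)]|.

Let equ (y : stacked n) : (y \in equator n) = (if y is inr _ then true else false).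
Proof.
by case: y => [v|i]; [apply/imsetP => -[]|apply: imset_f].
Qed.

Let inn (w : W) : (w \in inner) = (if w is inr _ then true else false).
Proof.
by case: w => [v|i]; [apply/imsetP => -[]|apply: imset_f].
Qed.

Let left_r : forall x y, stack_rel (compose d1 d2) d3 x y
  = same_part (@upper n) (compose d1 d2) x y || same_part (@lower n) d3 x y.
Proof. by []. Qed.

Let right_r : forall x y, stack_rel d1 (compose d2 d3) x y
  = same_part (@lower n) (compose d2 d3) x y || same_part (@upper n) d1 x y.
Proof. by move=> x y; rewrite orbC. Qed.

Let right_q : forall x y, q x y =
  [|| same_part a2 d2 x y, same_part a3 d3 x y | same_part a1 d1 x y].
Proof. by move=> x y; rewrite /q orbC orbA. Qed.


Let facts12 : [/\ forall v, j12 (upper v) = i12 (inl v),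
  forall z y, i12 z = j12 y -> exists2 v, z = inl v & y = upper v &
  forall w, (w \in codom i12) || (w \in codom j12)].
Proof.
split; first by case.
  move=> [[i|i]|i] [[k|k]|k] //= [->]; [by exists (inl k)|by exists (inr k)].
move=> [[i|i]|[i|i]]; apply/orP.
- by left; apply/codomP; exists (inl (inl i)).
- by right; apply/codomP; exists (inl (inr i)).
- by left; apply/codomP; exists (inr i).
- by left; apply/codomP; exists (inl (inr i)).
Qed.

Let facts23 : [/\ forall v, j23 (lower v) = i23 (inl v),
  forall z y, i23 z = j23 y -> exists2 v, z = inl v & y = lower v &
  forall w, (w \in codom i23) || (w \in codom j23)].
Proof.
split; first by case.
  move=> [[i|i]|i] [[k|k]|k] //= [->]; [by exists (inl k)|by exists (inr k)].
move=> [[i|i]|[i|i]]; apply/orP.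
- by right; apply/codomP; exists (inl (inl i)).
- by left; apply/codomP; exists (inl (inr i)).
- by left; apply/codomP; exists (inl (inl i)).
- by left; apply/codomP; exists (inr i).
Qed.

Lemma composeA : compose d1 (compose d2 d3) = compose (compose d1 d2) d3.
Proof.
have [i1 j1 i2 j2] := inj4; have [f1 f2 _] := facts12; have [g1 g2 _] := facts23.
apply: diagram_eq => v w; rewrite !same_compose.
rewrite (@glue_compose n _ d2 d3 d1 i23 j23 (@lower n) (@upper n) i2 j2
  (@lower_inj n) (@upper_inj n) g1 g2 a2 a3 a1 _ _ _ _ q _ right_q) //; try by case.
by rewrite (@glue_compose n _ d1 d2 d3 i12 j12 (@upper n) (@lower n) i1 j1
  (@upper_inj n) (@lower_inj n) f1 f2 a1 a2 a3 _ _ _ _ q) //; case.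
Qed.

Let cntA b : cnt b d1 d2 + cnt b (compose d1 d2) d3 = cnt b d2 d3 + cnt b d1 (compose d2 d3).
Proof.
have [i1 j1 i2 j2] := inj4; have [f1 f2 f3] := facts12; have [g1 g2 g3] := facts23.
have j1i y : (j12 y \in inner) = (y \in equator n) by rewrite inn equ; case: y.
have j2i y : (j23 y \in inner) = (y \in equator n) by rewrite inn equ; case: y.
have i1i k : i12 (inr k) \in inner by rewrite inn.
have i2i k : i23 (inr k) \in inner by rewrite inn.
transitivity (total b).
  refine (etrans _ (@glue_count n _ d1 d2 d3 i12 j12 (@upper n) (@lower n) i1 j1
    (@upper_inj n) (@lower_inj n) f1 f2 f3 inner i1i j1i a1 a2 a3 _ _ _
    (stack_rel (compose d1 d2) d3) q _ _ b)); try by [|case].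
  congr (_ + _); apply: eq_card => C; rewrite !inE; congr (_ && _).
  by have [Ceq|] := boolP (C \subset equator n) => //=; rewrite is_loopE.
transitivity #|[set K in conn_classes q | (K \subset inner) &&
   ([&& [disjoint K & marked d2 a2], [disjoint K & marked d3 a3] & [disjoint K & marked d1 a1]] == b)]|.
  apply: eq_card => K; rewrite !inE /free3; congr (_ && (_ && (_ == _))).
  by rewrite andbC andbA.
refine (esym (etrans _ (@glue_count n _ d2 d3 d1 i23 j23 (@lower n) (@upper n) i2 j2
    (@lower_inj n) (@upper_inj n) g1 g2 g3 inner i2i j2i a2 a3 a1 _ _ _
    (stack_rel d1 (compose d2 d3)) q right_r right_q b))); try by case.
congr (_ + _); apply: eq_card => C; rewrite !inE; congr (_ && _).
have [Ceq|] := boolP (C \subset equator n) => //=; rewrite is_loopE //.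
by rewrite andbC.
Qed.

Lemma n_loopsA : n_loops d1 d2 + n_loops (compose d1 d2) d3
               = n_loops d2 d3 + n_loops d1 (compose d2 d3).
Proof.
have E d d' : n_loops d d' = cnt true d d'.
  by apply: eq_card => C; rewrite !inE eqb_id.
by rewrite !E cntA.
Qed.

Lemma n_stringsA : n_strings d1 d2 + n_strings (compose d1 d2) d3
               = n_strings d2 d3 + n_strings d1 (compose d2 d3).
Proof.
have E d d' : n_strings d d' = cnt false d d'.
  by apply: eq_card => C; rewrite !inE eqbF_neg.
by rewrite !E cntA.
Qed.
End Assoc.

Section Identity.
Variable n : nat.
Local Notation V := ('I_n + 'I_n)%type.

Definition id_parts : {set {set 'I_n + 'I_n}} := [set [set inl i; inr i] | i : 'I_n].

Let idx (v : V) : 'I_n := match v with inl i => i | inr i => i end.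

Let id_partsE : id_parts = equivalence_partition (fun v w => idx v == idx w) [set: V].
Proof.
have E v : [set w in [set: V] | idx v == idx w] = [set inl (idx v); inr (idx v)].
  apply/setP=> w; rewrite !inE /=; apply/eqP/orP => [->|].
    by case: w => k; rewrite /= eqxx; [left|right].
  by case=> /eqP->.
apply/setP=> B; apply/imsetP/imsetP => [[i _ ->]|[v _ ->]].
  by exists (inl i) => //; rewrite E.
by exists (idx v); rewrite // E.
Qed.

Let idx_equiv : {in [set: V] & &, equivalence_rel (fun v w => idx v == idx w)}.
Proof. by move=> x y z _ _ _; split=> // /eqP->. Qed.

Lemma id_subproof : is_diagram id_parts.
Proof.
apply/andP; split.
  by rewrite id_partsE; apply: equivalence_partitionP; exact: idx_equiv.
by apply/forallP=> B; apply/implyP=> /imsetP[i _ ->]; rewrite cards2.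
Qed.

Definition id_diagram := Diagram id_subproof.

Lemma same_id v w : same id_diagram v w = (idx v == idx w).
Proof.
by rewrite /same /= id_partsE; apply: pblock_equivalence_partition; rewrite ?inE //; exact: idx_equiv.
Qed.

Section Retract.
Variables (d d' e : diagram n) (f : stacked n -> V) (g : V -> stacked n).
Hypothesis f_inl : forall v, f (inl v) = v.
Hypothesis fg : forall v, f (g v) = v.
Hypothesis conn_g : forall x, connect (stack_rel d d') x (g (f x)).
Hypothesis f_step : forall x y, stack_rel d d' x y -> same e (f x) (f y).
Hypothesis g_step : forall v w, same e v w -> stack_rel d d' (g v) (g w).

Let connE x y : connect (stack_rel d d') x y = same e (f x) (f y).
Proof.
apply/idP/idP.
  move: y; apply: connect_inv => [|y z _ xy yz]; first exact: same_refl.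
  exact: same_trans xy (f_step yz).
move=> xy; apply: connect_trans (conn_g x) _.
apply: connect_trans (connect1 (g_step xy)) _.
by rewrite (sym_connect_sym (@stack_rel_sym _ d d')).
Qed.

Lemma retract_compose : compose d d' = e.
Proof. by apply: diagram_eq => v w; rewrite same_compose connE !f_inl. Qed.

Let not_equator (C : {set stacked n}) : C \in components d d' -> C \subset equator n -> False.
Proof.
case/conn_classesP=> x -> /subsetP/(_ (inl (f x))).
by rewrite inE connE f_inl same_refl => /(_ isT)/imsetP[].
Qed.

Lemma retract_loops : n_loops d d' = 0.
Proof.
apply/eqP; rewrite cards_eq0; apply/eqP/setP=> C; rewrite !inE.
by apply/negP=> /and3P[Cc Ceq _]; apply: not_equator Ceq.
Qed.

Lemma retract_strings : n_strings d d' = 0.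
Proof.
apply/eqP; rewrite cards_eq0; apply/eqP/setP=> C; rewrite !inE.
by apply/negP=> /and3P[Cc Ceq _]; apply: not_equator Ceq.
Qed.
End Retract.

Variable d : diagram n.

Lemma id_composeE :
  [/\ compose id_diagram d = d, n_loops id_diagram d = 0 & n_strings id_diagram d = 0].
Proof.
pose f (x : stacked n) : V := match x with
  | inl (inl i) => inl i | inr i => inl i | inl (inr i) => inr i end.
have f_inl v : f (inl v) = v by case: v.
have fg v : f (lower v) = v by case: v.
have conn_g x : connect (stack_rel id_diagram d) x (lower (f x)).
  case: x => [[i|i]|i] /=; try exact: connect0.
  apply: connect1; apply/orP; left.
  have := same_partE id_diagram (inl i) (inr i) (@upper_inj n) => /= ->.
  by rewrite same_id.
have f_step x y : stack_rel id_diagram d x y -> same d (f x) (f y).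
  case/orP.
    case/(same_partP _ _ _ (@upper_inj n))=> a [b [-> ->]]; rewrite same_id.
    by case: a b => [a|a] [b|b] /= /eqP->; rewrite same_refl.
  by case/(same_partP _ _ _ (@lower_inj n))=> a [b [-> ->]]; rewrite !fg.
have g_step v w : same d v w -> stack_rel id_diagram d (lower v) (lower w).
  by move=> vw; apply/orP; right; rewrite same_partE //; apply: lower_inj.
split.
- exact: retract_compose f_inl conn_g f_step g_step.
- exact: retract_loops f_inl conn_g f_step g_step.
- exact: retract_strings f_inl conn_g f_step g_step.
Qed.

Lemma compose_idE :
  [/\ compose d id_diagram = d, n_loops d id_diagram = 0 & n_strings d id_diagram = 0].
Proof.
pose f (x : stacked n) : V := match x with
  | inl (inl i) => inl i | inr i => inr i | inl (inr i) => inr i end.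
have f_inl v : f (inl v) = v by case: v.
have fg v : f (upper v) = v by case: v.
have conn_g x : connect (stack_rel d id_diagram) x (upper (f x)).
  case: x => [[i|i]|i] /=; try exact: connect0.
  apply: connect1; apply/orP; right.
  have := same_partE id_diagram (inr i) (inl i) (@lower_inj n) => /= ->.
  by rewrite same_id.
have f_step x y : stack_rel d id_diagram x y -> same d (f x) (f y).
  case/orP.
    by case/(same_partP _ _ _ (@upper_inj n))=> a [b [-> ->]]; rewrite !fg.
  case/(same_partP _ _ _ (@lower_inj n))=> a [b [-> ->]]; rewrite same_id.
  by case: a b => [a|a] [b|b] /= /eqP->; rewrite same_refl.
have g_step v w : same d v w -> stack_rel d id_diagram (upper v) (upper w).
  by move=> vw; apply/orP; left; rewrite same_partE //; apply: upper_inj.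
split.
- exact: retract_compose f_inl conn_g f_step g_step.
- exact: retract_loops f_inl conn_g f_step g_step.
- exact: retract_strings f_inl conn_g f_step g_step.
Qed.
End Identity.

Import GRing.Theory.
Local Open Scope ring_scope.

(* The parameter [delta] weighs closed loops, [delta'] weighs open strings;   *)
(* the multiplication depending on them is put on this type below.            *)
Definition partial_brauer (K : fieldType) n (delta delta' : K) :=
  {ffun diagram n -> K^o}.

Section PartialBrauer.
Variables (K : fieldType) (n : nat) (delta delta' : K).
Local Notation A := (partial_brauer n delta delta').

HB.instance Definition _ := Vector.copy A {ffun diagram n -> K^o}.

Definition diagram_basis (d : diagram n) : A := [ffun e => (e == d)%:R].

Definition diagram_mul (d d' : diagram n) : A :=
  (delta ^+ n_loops d d' * delta' ^+ n_strings d d')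
    *: diagram_basis (compose d d').

Definition pb_mul (x y : A) : A :=
  \sum_d \sum_d' (x d * y d') *: diagram_mul d d'.

Let ext (X : diagram n -> A) (u : A) : A := \sum_d u d *: X d.

Let extD X : {morph ext X : u v / u + v}.
Proof.
move=> u v; rewrite /ext -big_split; apply: eq_bigr => d _ /=.
by rewrite ffunE scalerDl.
Qed.

Let extZ X a u : ext X (a *: u) = a *: ext X u.
Proof.
rewrite /ext scaler_sumr; apply: eq_bigr => d _ /=.
by rewrite ffunE scalerA.
Qed.

Let ext_basis X d : ext X (diagram_basis d) = X d.
Proof.
rewrite /ext (bigD1 d) //= ffunE eqxx scale1r big1 ?addr0 // => e ed.
by rewrite ffunE (negbTE ed) scale0r.
Qed.

Let ext_ext X Y u : ext X (ext Y u) = ext (fun d => ext X (Y d)) u.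
Proof.
have ext0 : ext X 0 = 0 by rewrite -(scale0r 0) extZ !scale0r.
by rewrite [ext Y u]/ext (big_morph (ext X) (extD X) ext0); apply: eq_bigr => d _; rewrite extZ.
Qed.

Let eq_ext X Y u : X =1 Y -> ext X u = ext Y u.
Proof. by move=> XY; apply: eq_bigr => d _; rewrite XY. Qed.

Let ext_cst a X u : ext (fun d => a *: X d) u = a *: ext X u.
Proof.
rewrite /ext scaler_sumr; apply: eq_bigr => d _.
by rewrite !scalerA mulrC.
Qed.

Let pb_mulE x y : pb_mul x y = ext (fun d => ext (diagram_mul d) y) x.
Proof.
apply: eq_bigr => d _; rewrite scaler_sumr; apply: eq_bigr => e _.
by rewrite scalerA.
Qed.

Let ext_id x : ext diagram_basis x = x.
Proof.
apply/ffunP=> d; rewrite sum_ffunE (bigD1 d) //= big1 => [|e /negbTE ed].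
  by rewrite addr0 ffunE ffunE eqxx [LHS]mulr1.
by rewrite ffunE ffunE eq_sym ed [LHS]mulr0.
Qed.

Let pb_mulA : associative pb_mul.
Proof.
move=> x y z; rewrite !pb_mulE !ext_ext; apply: eq_ext => d1.
rewrite [LHS]ext_ext [RHS]ext_ext; apply: eq_ext => d2; rewrite /diagram_mul.
rewrite extZ ext_basis -ext_cst [LHS]ext_ext; apply: eq_ext => d3.
rewrite extZ ext_basis !scalerA composeA; congr (_ *: _).
rewrite mulrACA [RHS]mulrACA -!exprD.
by rewrite n_loopsA n_stringsA.
Qed.

Let pb_mul1 : left_id (diagram_basis (id_diagram n)) pb_mul.
Proof.
move=> x; rewrite pb_mulE ext_basis -[RHS]ext_id; apply: eq_ext => d.
rewrite /diagram_mul; have [-> -> ->] := id_composeE d.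
by rewrite !expr0 mulr1 scale1r.
Qed.

Let pb_mulr1 : right_id (diagram_basis (id_diagram n)) pb_mul.
Proof.
move=> x; rewrite pb_mulE -[RHS]ext_id; apply: eq_ext => d; rewrite ext_basis.
rewrite /diagram_mul; have [-> -> ->] := compose_idE d.
by rewrite !expr0 mulr1 scale1r.
Qed.

Let pb_mulDl : left_distributive pb_mul +%R.
Proof. by move=> x y z; rewrite !pb_mulE extD. Qed.

Let pb_mulDr : right_distributive pb_mul +%R.
Proof.
move=> x y z; rewrite !pb_mulE /ext -big_split; apply: eq_bigr => d _ /=.
by rewrite -scalerDr -/(ext _ _) extD.
Qed.

Let pb_oner_neq0 : diagram_basis (id_diagram n) != 0.
Proof.
by apply/eqP=> /ffunP/(_ (id_diagram n))/eqP; rewrite !ffunE eqxx oner_eq0.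
Qed.

HB.instance Definition _ := GRing.Zmodule_isNzRing.Build A
  pb_mulA pb_mul1 pb_mulr1 pb_mulDl pb_mulDr pb_oner_neq0.

Let pb_scalerAl (a : K) (x y : A) : a *: (x * y) = (a *: x) * y.
Proof. by rewrite /GRing.mul /= !pb_mulE extZ. Qed.

Lemma pb_mul_basis d d' :
  diagram_basis d * diagram_basis d' = diagram_mul d d'.
Proof.
by apply: etrans (pb_mulE _ _) _; rewrite !ext_basis.
Qed.

HB.instance Definition _ := GRing.Lmodule_isLalgebra.Build K A pb_scalerAl.

Let pb_scalerAr (a : K) (x y : A) : a *: (x * y) = x * (a *: y).
Proof.
rewrite /GRing.mul /= !pb_mulE -ext_cst; apply: eq_ext => d.
by rewrite extZ.
Qed.

HB.instance Definition _ := GRing.Lalgebra_isAlgebra.Build K A pb_scalerAr.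
HB.instance Definition _ := Algebra_isFalgebra.Build K A.

End PartialBrauer.

Definition left_ideal (K : fieldType) (A : falgType K) (I : {vspace A}) :=
  (fullv * I <= I)%VS.

Definition simple_left_ideal (K : fieldType) (A : falgType K) (I : {vspace A}) :=
  [/\ left_ideal I, I != 0%VS &
      forall J : {vspace A}, left_ideal J -> (J <= I)%VS -> J = 0%VS \/ J = I].

(* The left regular module is a direct sum of simple submodules. Finite sums  *)
(* suffice since A is finite-dimensional.                                     *)
Definition semisimple (K : fieldType) (A : falgType K) :=
  exists m (I : 'I_m -> {vspace A}),
    [/\ forall i, simple_left_ideal (I i),
        directv (\sum_i I i) & (\sum_i I i)%VS = fullv].

Definition zariski_closed (K : fieldType) m (Z : 'rV[K]_m -> Prop) :=
  exists S : {mpoly K[m]} -> Prop,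
    forall x, Z x <-> (forall p, S p -> p.@[x ord0] = 0).

Definition zariski_open (K : fieldType) m (U : 'rV[K]_m -> Prop) :=
  zariski_closed (fun x => ~ U x).

(* Main.v *)
Require Import Defs.
From HB Require Import structures.
From mathcomp Require Import mpoly.
From mathcomp Require Import all_boot all_order all_algebra all_field.
From mathcomp Require Import boolp reals complex.

Set Implicit Arguments.
Unset Strict Implicit.
Unset Printing Implicit Defensive.

Import Order.TTheory GRing.Theory Num.Theory.
Local Open Scope ring_scope.

(* Let D(delta, delta') be the determinant of the trace form                  *)
(* (x, y) |-> tr(L_(xy)) of the regular representation in the basis of        *)
(* diagrams; it is a polynomial in delta and delta'. Where D does not vanish  *)
(* the algebra is semiprime: if x a x = 0 for all a, then every x a squares   *)
(* to zero, so x is in the radical of the trace form. A semiprime             *)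
(* finite-dimensional algebra is semisimple, and U is the locus D <> 0.       *)
(* To find a point of U, take delta = delta' = q, the number of elements of a *)
(* finite set T. Then d |-> [the coloring (a, b) is constant on each part of  *)
(* d], with a and b colorings of the top and bottom vertices by T, is a       *)
(* representation by real matrices, in which flipping d upside down           *)
(* transposes its matrix, and it is faithful when T is large. Hence the       *)
(* algebra has a positive definite form and an involution x |-> x' such that *)
(* L_x' is the adjoint of L_x, so tr(L_x' L_x) > 0 for x <> 0 and D(q, q) is  *)
(* not zero.                                                                  *)

(** Semisimplicity can fail only on the hypersurface D = 0: by [trace_form_semisimple],
    nondegeneracy of the trace form makes the algebra semiprime, and [semiprime_semisimple] splits
    off simple left ideals one at a time. That D is not the zero polynomial is seen at one point.
    There [card_middle_colorings] makes the coloring matrices multiplicative, [coloring_mx_free]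
    makes them independent, and [det_trace_form_mx_neq0] concludes by positivity of tr(L* L). *)

Section Semiprime.
Variables (K : fieldType) (A : falgType K).
Hypothesis semiprime : forall x : A, (forall a, x * a * x = 0) -> x = 0.

Lemma left_idealP (I : {vspace A}) :
  left_ideal I <-> forall a x, x \in I -> a * x \in I.
Proof.
split=> [/prodvP AI a x xI|AI]; first by rewrite AI ?memvf.
by apply/prodvP=> a x _; apply: AI.
Qed.

(** Right multiplication by [x] commutes with the left action, so its kernel is a left ideal. *)
Lemma left_ideal_annihilator (I : {vspace A}) x :
  left_ideal I -> left_ideal (I :&: lker (amulr x)).
Proof.
move/left_idealP=> AI; apply/left_idealP=> a y.
rewrite !memv_cap !memv_ker !lfunE /= => /andP[yI /eqP yx].
by rewrite AI // -mulrA yx mulr0 eqxx.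
Qed.

Lemma exists_simple_left_ideal (J : {vspace A}) : left_ideal J -> J != 0%VS ->
  exists2 I : {vspace A}, simple_left_ideal I & (I <= J)%VS.
Proof.
have [k] := ubnP (\dim J); elim: k J => // k IH J le_k AJ J0.
have [[I [AI IJ I0 nIJ]]|noI] := EM (exists I : {vspace A},
    [/\ left_ideal I, (I <= J)%VS, I != 0%VS & I != J]).
  have [|I' sI' I'I] := IH I _ AI I0; last by exists I' => //; apply: subv_trans IJ.
  rewrite ltnS in le_k; apply: leq_trans le_k.
  by rewrite (ltn_leqif (dimv_leqif_eq IJ)).
exists J => //; split=> // I AI IJ; have [->|I0] := eqVneq I 0%VS; first by left.
have [->|nIJ] := eqVneq I J; first by right.
by case: noI; exists I.
Qed.

(* By minimality I z = I for some z in I, so e z = z for some e in I, and the  *)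
(* annihilator of z in I, which contains x e - x, vanishes.                   *)
Lemma simple_left_ideal_idempotent (I : {vspace A}) : simple_left_ideal I ->
  exists2 e, e \in I & forall x, x \in I -> x * e = x.
Proof.
case=> AI I0 sI; have mI := iffLR (left_idealP I) AI.
have [x xI x0] : exists2 x, x \in I & x != 0.
  by exists (vpick I); rewrite ?memv_pick // vpick0.
(* Semiprimeness makes some x a x nonzero; z = a x then gives I z <> 0. *)
have [z zI xz] : exists2 z, z \in I & x * z != 0.
  have [a xax] : exists a, x * a * x != 0.
    apply: contrapT => no; case/eqP: x0; apply: semiprime => a.
    by apply: contrapT => /eqP xax; apply: no; exists a.
  by exists (a * x); rewrite ?mI // mulrA.
have [e eI ez] : exists2 e, e \in I & z = e * z.
  have AIz : left_ideal (amulr z @: I).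
    apply/left_idealP=> a _ /memv_imgP[y yI ->]; rewrite lfunE /= mulrA.
    by apply/memv_imgP; exists (a * y); rewrite ?mI // lfunE.
  have IzI : (amulr z @: I <= I)%VS.
    by apply/subvP=> _ /memv_imgP[y _ ->]; rewrite lfunE /= mI.
  have [Iz0|IzE] := sI _ AIz IzI.
    have : amulr z x \in (amulr z @: I)%VS by apply: memv_img.
    by rewrite Iz0 memv0 lfunE /= (negbTE xz).
  by move: zI; rewrite -{1}IzE => /memv_imgP[e eI ez]; exists e; rewrite // {1}ez lfunE.
exists e => // y yI; apply/eqP; rewrite -subr_eq0 -memv0.
have [|I0z|Iz] := sI _ (left_ideal_annihilator z AI); first exact: capvSl.
  rewrite -I0z memv_cap memv_ker lfunE /= mulrBl -mulrA -ez subrr eqxx andbT.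
  by rewrite memvB ?mI.
by move: xI; rewrite -Iz memv_cap memv_ker lfunE /= (negbTE xz) andbF.
Qed.

(** Peirce decomposition: writing x = x e + (x - x e) splits J into a simple ideal I and the part of
    J killed by right multiplication by e, of smaller dimension. *)
Lemma left_ideal_semisimple (J : {vspace A}) : left_ideal J ->
  exists m (I : 'I_m -> {vspace A}),
    [/\ forall i, simple_left_ideal (I i),
        directv (\sum_i I i) & (\sum_i I i)%VS = J].
Proof.
have [k] := ubnP (\dim J); elim: k J => // k IH J le_k AJ.
have [->|J0] := eqVneq J 0%VS.
  exists 0, (fun=> 0%VS); rewrite directvE /= !big_ord0 dimv0.
  by split=> //; case.
have [I sI IJ] := exists_simple_left_ideal AJ J0.
have [e eI Ie] := simple_left_ideal_idempotent sI.
have I0 : I != 0%VS by case: sI.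
pose J' := (J :&: lker (amulr e))%VS.
have IJ' : (I :&: J' = 0)%VS.
  apply/eqP; rewrite -subv0; apply/subvP=> x; rewrite !memv_cap memv_ker lfunE /=.
  by case/and3P=> xI _; rewrite Ie // memv0.
have IDJ' : (I + J' = J)%VS.
  apply/eqP; rewrite eqEsubv subv_add IJ capvSl; apply/subvP=> x xJ.
  have xeI : x * e \in I by case: sI => AI _ _; apply: (iffLR (left_idealP I)) eI.
  rewrite -(subrK (x * e) x) addrC memv_add // memv_cap (memvB xJ (subvP IJ _ xeI)).
  by rewrite memv_ker lfunE /= mulrBl (Ie (x * e)) ?subrr.
have dimJ : (\dim J = \dim I + \dim J')%N by rewrite -(dimv_disjoint_sum IJ') IDJ'.
have [|m [L [sL dL LJ']]] := IH J' _ (left_ideal_annihilator e AJ).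
  rewrite ltnS dimJ in le_k; apply: leq_trans le_k.
  by rewrite -[X in (X < _)%N]add0n ltn_add2r lt0n dimv_eq0.
exists m.+1, (fun i => if unlift ord0 i is Some j then L j else I).
have liftE i : (if unlift ord0 (lift ord0 i) is Some j then L j else I) = L i.
  by rewrite liftK.
split.
- by move=> i; case: unliftP => [j|] _.
- rewrite directvE /= !big_ord_recl unlift_none.
  under eq_bigr do rewrite liftE; under [X in (_ + X)%N]eq_bigr do rewrite liftE.
  by rewrite LJ' IDJ' dimJ; move: dL; rewrite directvE /= => /eqP <-; rewrite LJ'.
- by rewrite big_ord_recl unlift_none; under eq_bigr do rewrite liftE; rewrite LJ'.
Qed.

Lemma semiprime_semisimple : semisimple A.
Proof.
by apply: left_ideal_semisimple; apply/left_idealP=> *; rewrite memvf.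
Qed.
End Semiprime.

(* If M = C R is a rank factorization, then R C = 0 and tr M = tr (R C).      *)
Lemma mxtrace_square_zero (K : fieldType) m (M : 'M[K]_m) :
  M *m M = 0 -> \tr M = 0.
Proof.
have := col_base_full M; have := row_base_free M; have := mulmx_base M.
move: (\rank M) (col_base M) (row_base M) => r C R <- fR fC.
rewrite mxtrace_mulC mulmxA => /(congr1 (mulmx (pinvmx C))).
rewrite !mulmxA mulVpmx // mul1mx mulmx0 => /(congr1 (mulmx^~ (pinvmx R))).
by rewrite mul0mx -mulmxA mulmxVp // mulmx1 => ->; rewrite mxtrace0.
Qed.

(** * The trace form of the regular representation *)

Definition weight (S : comNzRingType) (delta delta' : S) n (d e : diagram n) : S :=
  delta ^+ n_loops d e * delta' ^+ n_strings d e.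

(** The trace of left multiplication by d e: only the f fixed up to a scalar meet the diagonal. Over
    a general ring [S] it can be taken with indeterminates as parameters and then evaluated. *)
Definition trace_form (S : comNzRingType) (delta delta' : S) n (d e : diagram n) : S :=
  weight delta delta' d e * \sum_(f | compose (compose d e) f == f)
    weight delta delta' (compose d e) f.

Definition trace_form_mx (S : comNzRingType) (delta delta' : S) n :
    'M[S]_#|{: diagram n}| :=
  \matrix_(i, j) trace_form delta delta' (enum_val i) (enum_val j).

Lemma det_trace_form_mx_morph (S S' : comNzRingType) (f : {rmorphism S -> S'})
    (delta delta' : S) n :
  f (\det (trace_form_mx delta delta' n)) = \det (trace_form_mx (f delta) (f delta') n).
Proof.
rewrite -det_map_mx; congr (\det _); apply/matrixP=> i j; rewrite !mxE.
rewrite /trace_form /weight !rmorphM !rmorphXn rmorph_sum; congr (_ * _).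
by apply: eq_bigr => e _; rewrite rmorphM !rmorphXn.
Qed.

Section RegularRepresentation.
Variables (K : fieldType) (n : nat) (delta delta' : K).
Local Notation A := (partial_brauer n delta delta').
Local Notation basis d := (diagram_basis delta delta' d).

Lemma diagram_basis_sum (x : A) : x = \sum_d x d *: basis d.
Proof.
apply/ffunP=> d; rewrite sum_ffunE (bigD1 d) //= big1 => [|e /negbTE ed].
  by rewrite addr0 !ffunE eqxx [RHS]mulr1.
by rewrite !ffunE eq_sym ed [LHS]mulr0.
Qed.

Definition coord_row (x : A) : 'rV[K]_#|{: diagram n}| := \row_i x (enum_val i).

Lemma coord_row_is_linear : linear coord_row.
Proof. by move=> a x y; apply/rowP=> i; rewrite !mxE !ffunE. Qed.
HB.instance Definition _ := GRing.isLinear.Build K A _ _ coord_row coord_row_is_linear.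

Lemma coord_row_inj : injective coord_row.
Proof.
move=> x y /rowP xy; apply/ffunP=> d.
by have := xy (enum_rank d); rewrite !mxE enum_rankK.
Qed.

(** Matrices act on coordinate rows from the right, hence the reversed order in [lmul_mxM]. *)
Definition lmul_mx (x : A) : 'M[K]_#|{: diagram n}| :=
  \matrix_i coord_row (x * basis (enum_val i)).

Lemma lmul_mx_is_linear : linear lmul_mx.
Proof.
move=> a x y; apply/row_matrixP=> i.
by rewrite linearP /= !rowK mulrDl -scalerAl linearP.
Qed.
HB.instance Definition _ := GRing.isLinear.Build K A _ _ lmul_mx lmul_mx_is_linear.

Lemma coord_row_basis i : coord_row (basis (enum_val i)) = delta_mx 0 i.
Proof. by apply/rowP=> j; rewrite !mxE ffunE (inj_eq enum_val_inj). Qed.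

Lemma sum_coord_row (x : A) : x = \sum_i coord_row x 0 i *: basis (enum_val i).
Proof.
rewrite [LHS]diagram_basis_sum (reindex _ (onW_bij _ (enum_val_bij _))) /=.
by apply: eq_bigr => i _; rewrite mxE.
Qed.

Lemma coord_rowM (x y : A) : coord_row (x * y) = coord_row y *m lmul_mx x.
Proof.
rewrite {1}(sum_coord_row y) mulr_sumr linear_sum mulmx_sum_row.
by apply: eq_bigr => i _; rewrite -scalerAr linearZ rowK.
Qed.

Lemma lmul_mxM (x y : A) : lmul_mx (x * y) = lmul_mx y *m lmul_mx x.
Proof.
by apply/row_matrixP=> i; rewrite row_mul !rowK -mulrA coord_rowM.
Qed.

Lemma trace_formE d e :
  trace_form delta delta' d e = \tr (lmul_mx (basis d * basis e)).
Proof.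
rewrite pb_mul_basis /diagram_mul linearZ mxtraceZ; congr (_ * _).
rewrite /mxtrace big_mkcond (reindex _ (onW_bij _ (enum_val_bij _))) /=.
apply: eq_bigr => i _; rewrite !mxE pb_mul_basis !ffunE eq_sym.
by case: eqP => _; [rewrite [RHS]mulr1|rewrite [RHS]mulr0].
Qed.

Lemma trace_form_mx_row (v : 'rV[K]_#|{: diagram n}|) j :
  (v *m trace_form_mx delta delta' n) 0 j =
  \tr (lmul_mx ((\sum_i v 0 i *: basis (enum_val i)) * basis (enum_val j))).
Proof.
rewrite mulr_suml linear_sum raddf_sum mxE; apply: eq_bigr => i _.
by rewrite -scalerAl linearZ /= mxtraceZ mxE trace_formE.
Qed.

Lemma trace_form_semisimple :
  \det (trace_form_mx delta delta' n) != 0 -> semisimple A.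
Proof.
move=> D0; apply: semiprime_semisimple => x xAx.
have free : row_free (trace_form_mx delta delta' n) by rewrite row_free_unit unitmxE unitfE.
apply: coord_row_inj; apply/eqP; rewrite linear0 -(mulmx_free_eq0 _ free).
apply/eqP/rowP=> j; rewrite trace_form_mx_row -sum_coord_row mxE.
(* For a basis diagram b, x b x b = 0 because x b x = 0. *)
by apply: mxtrace_square_zero; rewrite -lmul_mxM mulrA xAx mul0r linear0.
Qed.
End RegularRepresentation.

(** * Positivity of Gram matrices and adjoints *)

Section Adjoint.
Local Open Scope sesquilinear_scope.
Variable K : numClosedFieldType.
Implicit Types m p q : nat.

Lemma trmxCM m p q (M : 'M[K]_(m, p)) (N : 'M_(p, q)) :
  (M *m N)^t* = N^t* *m M^t*.
Proof. by rewrite trmx_mul map_mxM. Qed.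

(** The trace is the sum of the squared moduli of the entries of [X]. *)
Lemma mxtrace_adj_eq0 m p (X : 'M[K]_(m, p)) : \tr (X^t* *m X) = 0 -> X = 0.
Proof.
move=> tr0; apply/matrixP=> i j; rewrite mxE; apply/eqP.
have ge0 k l : 0 <= X k l * (X k l)^* by rewrite mul_conjC_ge0.
have: \sum_l \sum_k X k l * (X k l)^* = 0.
  rewrite -[RHS]tr0; apply: eq_bigr => l _; rewrite mxE; apply: eq_bigr => k _.
  by rewrite !mxE mulrC.
move/psumr_eq0P=> /(_ (fun l _ => sumr_ge0 _ (fun k _ => ge0 k l))) /(_ j isT).
move/psumr_eq0P=> /(_ (fun k _ => ge0 k j)) /(_ i isT) /eqP.
by rewrite mul_conjC_eq0.
Qed.

(** If v kills the Gram matrix, then v B has norm zero, so v B = 0 and v = 0. *)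
Lemma gram_unitmx m p (B : 'M[K]_(m, p)) : row_free B -> B *m B^t* \in unitmx.
Proof.
move=> fB; rewrite -row_free_unit; apply: inj_row_free => v.
move/(congr1 (mulmx^~ (v^t*))); rewrite /= mul0mx -!mulmxA -trmxCM mulmxA => vB.
have: (v *m B)^t* = 0 by apply: mxtrace_adj_eq0; rewrite trmxCK vB mxtrace0.
move/(congr1 (fun M => M^t*)); rewrite trmxCK => vB0; apply/eqP.
by rewrite -(mulmx_free_eq0 _ fB) vB0; apply/eqP/matrixP=> i j; rewrite !mxE conjC0.
Qed.

(* L' is the adjoint of L for the form with Gram matrix H = B B^t*. The rows  *)
(* of C = H^-1 B form the basis dual to the rows of B, and tr (L' L) is the   *)
(* sum of the squared moduli of the entries of C^t* L B.                      *)
Lemma mxtrace_gram_adj_eq0 m p (B : 'M[K]_(m, p)) (L L' : 'M_m) : row_free B ->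
  L' *m (B *m B^t*) = B *m B^t* *m L^t* -> \tr (L' *m L) = 0 -> L = 0.
Proof.
move=> fB; have := gram_unitmx fB; set H := B *m B^t* => uH L'H.
have Hadj : H^t* = H by rewrite trmxCM trmxCK.
have uHadj : (invmx H)^t* = invmx H.
  by rewrite trmx_inv map_invmx Hadj.
pose C := invmx H *m B.
have CC : C *m C^t* = invmx H.
  by rewrite trmxCM uHadj mulmxA -[C *m B^t*]mulmxA mulVmx // mul1mx.
have BC : B *m C^t* = 1%:M by rewrite trmxCM uHadj mulmxA -/H mulmxV.
clearbody C; have -> : L' = H *m L^t* *m C *m C^t*.
  by rewrite -mulmxA CC -L'H mulmxK.
have -> : H *m L^t* *m C *m C^t* *m L = B *m ((C^t* *m L *m B)^t* *m (C^t* *m L)).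
  by rewrite !trmxCM trmxCK /H !mulmxA.
rewrite mxtrace_mulC -(mulmxA (_ ^t*)) => /mxtrace_adj_eq0/eqP.
rewrite mulmx_free_eq0 // => /eqP/(congr1 (mulmx B)).
by rewrite mulmxA BC mul1mx mulmx0.
Qed.
End Adjoint.

(** * Flipping diagrams upside down *)

Definition flip n (v : 'I_n + 'I_n) : 'I_n + 'I_n :=
  match v with inl i => inr i | inr i => inl i end.

Lemma flipK n : involutive (@flip n). Proof. by case. Qed.

Section Transpose.
Variables (n : nat) (d : diagram n).

Let flip_equiv : {in [set: 'I_n + 'I_n] & &,
  equivalence_rel (fun v w => same d (flip v) (flip w))}.
Proof.
move=> u v w _ _ _; split=> [|uv]; first exact: same_refl.
by apply/idP/idP; apply: same_trans; rewrite // same_sym.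
Qed.

Lemma transpose_subproof : is_diagram
  (equivalence_partition (fun v w => same d (flip v) (flip w)) [set: 'I_n + 'I_n]).
Proof.
apply/andP; split; first exact: equivalence_partitionP.
apply/forallP=> B; apply/implyP=> /imsetP[v _ ->].
have -> : [set w in [set: 'I_n + 'I_n] | same d (flip v) (flip w)] =
    @flip n @^-1: pblock d (flip v) by apply/setP=> w; rewrite !inE.
rewrite on_card_preimset; last exact/onW_bij/inv_bij/flipK.
have ed : partition d [set: 'I_n + 'I_n] by case/andP: (diagramP d).
have vd : flip v \in cover d by rewrite (cover_partition ed) inE.
by case/andP: (card_part (pblock_mem vd)).
Qed.

Definition transpose := Diagram transpose_subproof.

Lemma same_transpose v w : same transpose v w = same d (flip v) (flip w).
Proof. by apply: pblock_equivalence_partition; rewrite ?inE. Qed.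
End Transpose.

(** * Counting colorings of stacked diagrams *)

Section Colorings.
Variables (n : nat) (T : finType).
Implicit Types (d e : diagram n) (a b m : {ffun 'I_n -> T}).

Definition compatible d (f : 'I_n + 'I_n -> T) :=
  [forall v, forall w, same d v w ==> (f v == f w)].

Lemma compatibleP d f :
  reflect (forall v w, same d v w -> f v = f w) (compatible d f).
Proof.
apply: (iffP idP) => [/forallP H v w vw|H].
  by have /forallP/(_ w)/implyP/(_ vw)/eqP := H v.
by apply/forallP=> v; apply/forallP=> w; apply/implyP=> /H->.
Qed.

Definition join a b (v : 'I_n + 'I_n) : T :=
  match v with inl i => a i | inr i => b i end.

Lemma compatible_transpose d a b :
  compatible (transpose d) (join a b) = compatible d (join b a).
Proof.
have joinE v : join a b v = join b a (flip v) by case: v.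
apply/compatibleP/compatibleP => H v w; last first.
  by rewrite same_transpose !joinE; apply: H.
by have := H (flip v) (flip w); rewrite same_transpose !joinE !flipK.
Qed.

Section Stack.
Variables (d e : diagram n) (a b : {ffun 'I_n -> T}).

Let stack_coloring m (x : stacked n) : T :=
  match x with inl v => join a b v | inr i => m i end.

Let stack_coloringP m :
  reflect (forall x y, connect (stack_rel d e) x y -> stack_coloring m x = stack_coloring m y)
          (compatible d (join a m) && compatible e (join m b)).
Proof.
have up v : stack_coloring m (upper v) = join a m v by case: v.
have lo v : stack_coloring m (lower v) = join m b v by case: v.
apply: (iffP andP) => [[/compatibleP cd /compatibleP ce] x|H]; last first.
  split; apply/compatibleP=> v w vw; rewrite -?up -?lo; apply/H/connect1/orP.
    by left; rewrite same_partE //; apply: upper_inj.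
  by right; rewrite same_partE //; apply: lower_inj.
apply: connect_inv => // y z _ -> /orP[] /same_partP.
  by case/(_ (@upper_inj n))=> v [w [-> -> /cd]]; rewrite !up.
by case/(_ (@lower_inj n))=> v [w [-> -> /ce]]; rewrite !lo.
Qed.

Let inner := [set C in components d e | C \subset equator n].
Let innerT : finType := {C | C \in inner}.
Let cls (x : stacked n) := [set y | connect (stack_rel d e) x y].

Let conn_sym : connect_sym (stack_rel d e).
Proof. exact/sym_connect_sym/stack_rel_sym. Qed.

Let cls_inner x : (cls x \in inner) = (cls x \subset equator n).
Proof.
by rewrite inE; case: conn_classesP => // -[]; exists x.
Qed.

Let innerP (p : innerT) : exists i, val p = cls (inr i).
Proof.
have := valP p; rewrite inE => /andP[/conn_classesP[x ->] /subsetP/(_ x)].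
by rewrite inE connect0 => /(_ isT)/imsetP[i _ ->]; exists i.
Qed.

(** Only the components inside the equator can be colored freely, by [u]; any other component
    reaches the top or bottom, where [a] and [b] force its color. *)
Let extend (u : {ffun innerT -> T}) : {ffun 'I_n -> T} :=
  [ffun i => if insub (cls (inr i)) is Some p then u p
             else odflt (a i) (omap (join a b) [pick v | inl v \in cls (inr i)])].

Let extend_inner u (p : innerT) x : x \in val p -> stack_coloring (extend u) x = u p.
Proof.
have [j pj] := innerP p; move=> xp.
have px : val p = cls x.
  apply/setP=> y; move: xp; rewrite pj !inE => jx.
  exact: (same_connect conn_sym jx).
have := cls_inner x; rewrite -px (valP p) => /esym/subsetP/(_ x xp)/imsetP[i _ xi].
by rewrite xi /= ffunE -xi -px valK.
Qed.

Let extend_outer u v x : compatible (compose d e) (join a b) ->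
  connect (stack_rel d e) x (inl v) -> stack_coloring (extend u) x = join a b v.
Proof.
move/compatibleP=> cab; case: x => [w|i] xv.
  by apply: cab; rewrite same_compose.
rewrite /= ffunE insubN; last first.
  by rewrite cls_inner; apply/subsetPn; exists (inl v); rewrite ?inE //; apply/imsetP=> -[].
case: pickP => [w|/(_ v)]; rewrite inE ?xv // => xw /=.
by apply: cab; rewrite same_compose; apply: connect_trans xv; rewrite conn_sym.
Qed.

(** A compatible coloring is constant on components. The forced colors agree exactly when [a] and
    [b] are compatible with the composite, and each loop or string in the equator contributes a
    factor [#|T|]. *)
Lemma card_middle_colorings :
  #|[set m | compatible d (join a m) && compatible e (join m b)]| =
  (compatible (compose d e) (join a b) * #|T| ^ (n_loops d e + n_strings d e))%N.
Proof.
have -> : (n_loops d e + n_strings d e)%N = #|inner|.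
  rewrite -(cardsID [set C | is_loop d e C] inner); congr addn; apply: eq_card => C;
    by rewrite !inE -?andbA //= [RHS]andbC -andbA.
have [cab|nab] := boolP (compatible _ _); last first.
  apply/eqP; rewrite cards_eq0; apply/eqP/setP=> m; rewrite !inE.
  apply/stack_coloringP=> H; case/compatibleP: nab => v w; rewrite same_compose.
  exact: H.
rewrite mul1n -[#|inner|]card_sig -card_ffun -cardsT -(card_in_imset (f := extend)); last first.
  move=> u u' _ _ uu'; apply/ffunP=> p; have [i pi] := innerP p.
  have ip : inr i \in val p by rewrite pi inE connect0.
  by rewrite -(extend_inner u ip) -(extend_inner u' ip) uu'.
congr #|pred_of_set _|; apply/setP=> m; rewrite inE.
apply/stack_coloringP/imsetP => [H|[u _ ->] x y xy]; last first.
  have [xe|] := boolP (cls x \in inner).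
    pose p : innerT := exist (fun C => C \in inner) _ xe.
    have in_p z : connect (stack_rel d e) x z -> z \in val p by rewrite inE.
    by rewrite !(extend_inner u (in_p _ _)) ?connect0.
  rewrite cls_inner => /subsetPn[[v|i]]; last by rewrite imset_f.
  rewrite inE => xv _; rewrite !(@extend_outer u v) //.
  by apply: connect_trans xv; rewrite conn_sym.
have /fin_all_exists[u uE] (p : innerT) : exists t, forall i, inr i \in val p -> m i = t.
  have [i pi] := innerP p; exists (m i) => j; rewrite pi inE conn_sym; exact: H.
exists [ffun p => u p] => //; apply/ffunP=> i.
have [ie|] := boolP (cls (inr i) \in inner).
  pose p : innerT := exist (fun C => C \in inner) _ ie.
  have ip : inr i \in val p by rewrite inE connect0.
  by rewrite (uE _ _ ip); have /= -> := extend_inner [ffun p => u p] ip; rewrite ffunE.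
rewrite cls_inner => /subsetPn[[v|j]]; last by rewrite imset_f.
rewrite inE => iv _; have /= -> := extend_outer [ffun p => u p] cab iv.
exact: (H _ _ iv).
Qed.
End Stack.
End Colorings.

(** * The coloring representation at delta = delta' = #|T| *)

Section ColoringRepresentation.
Local Open Scope sesquilinear_scope.
Variables (K : numClosedFieldType) (n : nat) (T : finType).
Local Notation W := ({ffun 'I_n -> T} * {ffun 'I_n -> T})%type.
Local Notation q := (#|T|%:R : K).
Local Notation basis d := (diagram_basis q q d).
Implicit Types (d e : diagram n) (x : partial_brauer n q q).

(** Each row is the flattened coloring matrix of a diagram, so row freeness means that the
    representation is faithful. *)
Definition coloring_mx : 'M[K]_(#|{: diagram n}|, #|{: W}|) :=
  \matrix_(i, f) (compatible (enum_val i) (join (enum_val f).1 (enum_val f).2))%:R.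

(* Left multiplication by the matrix of [d] on matrices indexed by colorings. *)
Definition coloring_lmul_mx d : 'M[K]_#|{: W}| :=
  \matrix_(f, g) (((enum_val f).2 == (enum_val g).2)
    && compatible d (join (enum_val g).1 (enum_val f).1))%:R.

Lemma coloring_lmul_mx_transpose d :
  coloring_lmul_mx (transpose d) = (coloring_lmul_mx d)^t*.
Proof.
by apply/matrixP=> f g; rewrite !mxE conjC_nat compatible_transpose eq_sym.
Qed.

(** Multiplicativity of the representation: the matrix product sums over middle colorings, whose
    number supplies the weight. *)
Lemma lmul_mx_basis_coloring d :
  lmul_mx (basis d) *m coloring_mx = coloring_mx *m coloring_lmul_mx d.
Proof.
apply/matrixP=> i f; rewrite !mxE; case Ef: (enum_val f) => [a b].
transitivity (weight q q d (enum_val i) * (compatible (compose d (enum_val i)) (join a b))%:R).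
  rewrite (bigD1 (enum_rank (compose d (enum_val i)))) //= big1 => [|j jd].
    by rewrite addr0 !mxE pb_mul_basis !ffunE enum_rankK eqxx Ef [_ *: _]mulr1.
  rewrite !mxE pb_mul_basis !ffunE -(can_eq enum_valK) enum_rankK in jd *.
  by rewrite (negbTE jd) [_ *: _]mulr0 mul0r.
transitivity (\sum_(g : W) (compatible (enum_val i) (join g.1 g.2))%:R *
    ((g.2 == b) && compatible d (join a g.1))%:R : K); last first.
  rewrite (reindex _ (onW_bij _ (enum_val_bij _))) /=.
  by apply: eq_bigr => g _; rewrite !mxE Ef.
pose F m b' : K := (compatible (enum_val i) (join m b'))%:R *
    ((b' == b) && compatible d (join a m))%:R.
rewrite -(pair_bigA _ F) /= /F /weight -!natrX -!natrM -expnD mulnC.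
rewrite -card_middle_colorings -sum1_card natr_sum big_mkcond /=.
apply: eq_bigr => m _; rewrite inE (bigD1 b) //= big1 => [|b' /negbTE ->]; last exact: mulr0.
by rewrite addr0 eqxx -natrM mulnb andbC; case: ifP.
Qed.

(** The conjugate-linear extension of the flip, whose left multiplication is adjoint to that of [x]
    for the Gram form of [coloring_mx]. *)
Definition star x : partial_brauer n q q := \sum_d (x d)^* *: basis (transpose d).

Lemma lmul_mx_coloring x :
  lmul_mx x *m coloring_mx = coloring_mx *m \sum_d x d *: coloring_lmul_mx d.
Proof.
rewrite {1}(diagram_basis_sum x) linear_sum mulmx_suml mulmx_sumr.
apply: eq_bigr => d _.
by rewrite linearZ -scalemxAl lmul_mx_basis_coloring scalemxAr.
Qed.

Lemma lmul_mx_star_coloring x :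
  lmul_mx (star x) *m coloring_mx =
  coloring_mx *m (\sum_d x d *: coloring_lmul_mx d)^t*.
Proof.
rewrite /star linear_sum mulmx_suml linear_sum map_mx_sum mulmx_sumr.
apply: eq_bigr => d _; rewrite !linearZ map_mxZ /= -scalemxAl.
by rewrite lmul_mx_basis_coloring coloring_lmul_mx_transpose scalemxAr.
Qed.

(** An x in the radical of the trace form satisfies tr(L_(star x) L_x) = 0, so L_x = 0 by positivity
    and x = x 1 = 0. *)
Lemma det_trace_form_mx_neq0 : row_free coloring_mx ->
  \det (trace_form_mx q q n) != 0.
Proof.
move=> fB; apply/negP=> /det0P[v v0 vG].
pose x : partial_brauer n q q := \sum_i v 0 i *: basis (enum_val i).
have tr0 y : \tr (lmul_mx (x * y)) = 0.
  rewrite (sum_coord_row y) mulr_sumr linear_sum raddf_sum big1 // => j _.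
  by rewrite -scalerAr linearZ /= mxtraceZ /x -trace_form_mx_row vG [X in _ * X]mxE mulr0.
have L0 : lmul_mx x = 0.
  apply: (mxtrace_gram_adj_eq0 (L' := lmul_mx (star x)) fB); last by rewrite -lmul_mxM tr0.
  by rewrite mulmxA lmul_mx_star_coloring -!mulmxA -!trmxCM lmul_mx_coloring.
case/eqP: v0; apply/rowP=> i.
have x0 : x = 0 by apply: coord_row_inj; rewrite -[x]mulr1 coord_rowM L0 mulmx0 linear0.
have : coord_row x = v.
  rewrite linear_sum {2}(row_sum_delta v); apply: eq_bigr => j _.
  by rewrite linearZ /= coord_row_basis.
by rewrite x0 linear0 => <-.
Qed.
End ColoringRepresentation.

(* With the set of vertex sets as colors, [pblock d] is a coloring compatible *)
(* exactly with the diagrams finer than [d], so the matrix is unitriangular.  *)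
Lemma coloring_mx_free (K : numClosedFieldType) n :
  row_free (coloring_mx K n {set 'I_n + 'I_n}).
Proof.
apply: inj_row_free => v vB; apply/eqP; apply: contraT => /rV0Pn[i0 vi0].
(* In the support of [v], a diagram d with fewest related pairs has no other diagram finer than it,
   so the column of [pblock d] isolates its coefficient. *)
pose size_same d := #|[set p | @same n d p.1 p.2]|.
case: (arg_minnP (P := fun i => v 0 i != 0) (fun i => size_same (enum_val i)) vi0).
move=> i vi mini; set d := enum_val i.
pose f : {ffun 'I_n -> {set 'I_n + 'I_n}} * {ffun 'I_n -> {set 'I_n + 'I_n}} :=
  ([ffun j => pblock d (inl j)], [ffun j => pblock d (inr j)]).
have fE w : join f.1 f.2 w = pblock d w by case: w => j; rewrite /= ffunE.
move/rowP/(_ (enum_rank f)): vB; rewrite !mxE (bigD1 i) //= big1 => [|j ji].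
  rewrite addr0 mxE enum_rankK -/d.
  have -> : compatible d (join f.1 f.2).
    by apply/compatibleP=> u w uw; rewrite !fE; apply: same_pb.
  by rewrite mulr1 => vi'; rewrite vi' eqxx in vi.
rewrite mxE enum_rankK; have [vj|vj] := eqVneq (v 0 j) 0; first by rewrite vj mul0r.
have [/compatibleP H|] := boolP (compatible _ _); last by rewrite mulr0.
case/eqP: ji; apply: enum_val_inj; apply: diagram_eq => u w.
have : [set p | same (enum_val j) p.1 p.2] == [set p | same d p.1 p.2].
  rewrite eqEcard [(#|_| <= _)%N]mini // andbT; apply/subsetP=> -[s t]; rewrite !inE /=.
  by move/H; rewrite !fE /same => ->; apply: same_refl.
by move/eqP/setP/(_ (u, w)); rewrite !inE.
Qed.

Theorem corollary8 (R : realType) (n : nat) (n_gt0 : (0 < n)%N) :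
  exists U : 'rV[R[i]]_2 -> Prop,
    [/\ zariski_open U,
        exists x : 'rV[R[i]]_2, U x &
        forall x : 'rV[R[i]]_2, U x ->
          semisimple (partial_brauer n (x ord0 ord0) (x ord0 ord_max))].
Proof.
pose D : {mpoly R[i][2]} := \det (trace_form_mx 'X_ord0 'X_ord_max n).
have DE (x : 'rV[R[i]]_2) :
    D.@[x ord0] = \det (trace_form_mx (x ord0 ord0) (x ord0 ord_max) n).
  by rewrite (det_trace_form_mx_morph (meval (x ord0))) /= !mevalXU.
exists (fun x => D.@[x ord0] <> 0); split.
- exists (fun p => p = D) => x; split=> [nD p ->|D0 []]; last exact: D0.
  exact: contrapT.
(* Both parameters equal the number of colors used in [coloring_mx_free]. *)
- exists (\row_i #|{set 'I_n + 'I_n}|%:R); rewrite DE !mxE; apply/eqP.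
  exact/det_trace_form_mx_neq0/coloring_mx_free.
- by move=> x; rewrite DE => /eqP; apply: trace_form_semisimple.
Qed.
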